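(* Consider the path geometry of horocycles in the hyperbolic plane, with 3-manifold identified with $\mathrm{SL}_2(\mathbb{R})$ as described in the context. (i) Each chain of the horocycle path geometry, up to the action of $\mathrm{SL}_2(\mathbb{R})$, projects to a curve in the hyperbolic plane, given in the upper half-plane model $\{(x,y): y>0\}$ by $$(x^2+y^2)^2-[4cx+(c^2+4)y](x^2+y^2)+(6c^2-2)x^2+2c^3xy+6y^2-4c(c^2-1)x-(c^4-3c^2+4)y+(c^2-1)^2=0,$$ where $c\in\mathbb{R}$, $c\ne0$. (ii) This curve is the projection of a chain in $\mathrm{SL}_2(\mathbb{R})$, namely the solution $g(\tau)=(\mathbf{r}(\tau)\,|\,\mathbf{h}(\tau))$ (with columns $\mathbf r,\mathbf h\in\mathbb{R}^2$), passing through $\mathrm{id}\in\mathrm{SL}_2(\mathbb{R})$ at $\tau=0$, of $$\mathbf{r}'=c\,(\sec2\tau)\,\mathbf{r}+\mathbf{h},\qquad \mathbf{h}'=-\left[1+c\,(c+2\sin2\tau)\sec^22\tau\right]\mathbf{r}-c\,(\sec2\tau)\,\mathbf{h}.$$ (iii) The projection of this chain to the Hooke plane is the Hooke ellipse $(x-cy)^2+y^2=1$. The horocycles along this chain, in the upper half-plane model, all pass through $(c,1)$, the point corresponding to this Hooke ellipse. (iv) The chains corresponding to $c$ and $-c$ are congruent via an outer automorphism of $\mathrm{SL}_2(\mathbb{R})$ (conjugation by $\mathrm{diag}(-1,1)\in\mathrm{GL}_2(\mathbb{R})$), acting by reflection about the $y$-axis.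
   Context: **The path geometry.** A Hooke ellipse (of area $\pi$) is an ellipse centered at the origin of $\mathbb{R}^2$ of area $\pi$; the Hooke plane is $\mathbb{R}^2\setminus\{0\}$. Hooke ellipses are parametrized by the upper half-plane: $(a,b)$, $b>0$, corresponds to the ellipse $x^2-2axy+(a^2+b^2)y^2=b$. The upper half-plane with its hyperbolic metric is the hyperbolic plane; for $\mathbf r\in\mathbb{R}^2\setminus\{0\}$ the set of Hooke ellipses through $\mathbf{r}$ is a horocycle in it (a circle tangent to the real axis, or a horizontal line). Let $M$ be the manifold of pairs $(\mathbf{r},\mathcal{E})$, $\mathbf r\in\mathbb{R}^2\setminus\{0\}$, $\mathcal{E}$ a Hooke ellipse of area $\pi$ with $\mathbf{r}\in\mathcal{E}$. Let $L_1,L_2\subset TM$ be tangent to the fibers of $(\mathbf r,\mathcal E)\mapsto\mathbf r$ and $(\mathbf r,\mathcal E)\mapsto\mathcal E$, respectively. $(M,L_1,L_2)$ is the path geometry of Hooke ellipses of area $\pi$; the horocycle path geometry is its dual $(M,L_2,L_1)$, which has the same chains (a horocycle corresponds to $\mathbf r$, a point of the hyperbolic plane to $\mathcal E$). $\mathrm{SL}_2(\mathbb{R})$ acts simply transitively on $M$ via its linear action on $\mathbb{R}^2$; $M$ is identified with $\mathrm{SL}_2(\mathbb{R})$ by $g\mapsto(g\mathbf{r}_0,g\mathcal{E}_0)$, $\mathbf{r}_0=(1,0)^t$, $\mathcal{E}_0=\{x^2+y^2=1\}$. So $g=(\mathbf r|\mathbf h)$ projects to $\mathbf r$ in the Hooke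 plane and to $g\cdot i$ (fractional linear action) in the upper half-plane $\{x+iy: y>0\}$. **Fefferman metric.** A path geometry is a smooth 3-manifold $M$ with an ordered pair of smooth line fields $L_1,L_2\subset TM$ spanning a contact distribution $D=L_1\oplus L_2$. Let $D^*=D\setminus(L_1\cup L_2)$ and $\mathbb{S}D^*$ the bundle over $M$ of rays $[X]=\mathbb{R}^+X$, $X\in D^*$. Let $J(X_1+X_2)=X_1-X_2$ for $X_i\in L_i$. Fix a contact form $\eta^3$, $D=\ker\eta^3$. Adapted coframes are the local coframes $(\eta^1,\eta^2,\eta^3)$ with $d\eta^3=\eta^1\wedge\eta^2$, $\eta^1|_{L_2}=0$, $\eta^2|_{L_1}=0$. They are the local sections of a principal $\mathbb{R}^*$-bundle $B\to M$, a subbundle of the coframe bundle, with $s\in\mathbb{R}^*$ acting by $(\eta^1,\eta^2,\eta^3)\mapsto(\eta^1/s,s\eta^2,\eta^3)$. Let $\omega^1,\omega^2,\omega^3$ be the tautological 1-forms on $B$. There is a unique $\mathbb{R}^*$-connection form $\alpha$ on $B$ with $d\omega^1=-\alpha\wedge\omega^1+a_1\omega^2\wedge\omega^3$, $d\omega^2=\alpha\wedge\omega^2+a_2\omega^3\wedge\omega^1$, $d\omega^3=\omega^1\wedge\omega^2$ for some functions $a_1,a_2$; moreover $d\alpha=b_1\omega^2\wedge\omega^3+b_2\omega^3\wedge\omega^1+K\omega^1\wedge\omega^2$ for some functions $b_1,b_2,K$. Set $\sigma=-\frac23\alpha+\frac16K\omega^3$ and $\mathrm{g}=\omega^1\cdot\omega^2+\omega^3\cdot\sigma$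 (symmetric products), a metric of signature $(2,2)$ on $B$. The map $h:B\to\mathbb{S}D^*$, $h(u)=[X]$ with $u^1(X)=u^2(X)=1$, $u^3(X)=0$, is a diffeomorphism onto an open subset $\mathbb{S}D^+$, and $J\circ h$ is a diffeomorphism onto its complement; transporting $\mathrm{g}$ by $h$ and $J\circ h$ gives a metric on $\mathbb{S}D^*$ whose conformal class does not depend on $\eta^3$: the Fefferman conformal class. **Chains.** A chain is the projection to $M$ of an unparametrized non-vertical null geodesic of the Fefferman conformal metric on $\mathbb{S}D^*$; chains are understood to be curves transverse to $D$.
   Formalization: (i) excepts chains congruent to the diagonal subgroup, which project to geodesics; in (ii), (iii) τ lies in (-π/4, π/4), so the chain projects to one branch of the curve (the other is a translate of the chain of -c) and to the open arc |y| < x - cy of the ellipse. *)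

(* Defs.v *)
From Stdlib Require Import Reals.
From Coquelicot Require Import Coquelicot.
Open Scope R_scope.

(** Forms are written index-free: a k-form is evaluated on a base point and on
    k vectors, and vectors are extended as constant vector fields when they are
    differentiated. *)

Section Calculus.
Context {V : NormedModule R_AbsRing}.

Definition dirD (f : V -> R) (x v : V) : R :=
  Derive (fun t => f (plus x (scal t v))) 0.

Fixpoint Ck (k : nat) (U : V -> Prop) (f : V -> R) : Prop :=
  (forall x, U x -> continuous f x) /\
  match k with
  | O => True
  | S k' => forall v : V,
      (forall x, U x -> ex_derive (fun t : R => f (plus x (scal t v))) 0) /\
      Ck k' U (fun x => dirD f x v)
  end.

Definition smooth (U : V -> Prop) (f : V -> R) : Prop := forall k, Ck k U f.

Definition form1 : Type := V -> V -> R.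
Definition form2 : Type := V -> V -> V -> R.

Definition is_form1 (U : V -> Prop) (w : form1) : Prop :=
  (forall x, U x -> is_linear (w x)) /\
  (forall v, smooth U (fun x => w x v)).

Definition wedge (w1 w2 : form1) : form2 :=
  fun x v v' => w1 x v * w2 x v' - w1 x v' * w2 x v.

Definition dform (w : form1) : form2 :=
  fun x v v' => dirD (fun y => w y v') x v - dirD (fun y => w y v) x v'.

(** Null geodesics of a pseudo-Riemannian metric [g] as unparametrized curves:
    [nabla_{b'} b' = mu b'] for some function [mu].  The equation is lowered
    with [g], so that only Christoffel symbols of the first kind occur:
    [g (nabla_{b'} b', w)
       = g (b'', w) + (D_{b'} g)(b', w) - 1/2 (D_w g)(b', b')]. *)
Definition null_geodesic (a b : Rbar) (g : V -> V -> V -> R) (c : R -> V)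
    : Prop :=
  exists c1 c2 : R -> V, forall t : R, Rbar_lt a t -> Rbar_lt t b ->
    is_derive c t (c1 t) /\ is_derive c1 t (c2 t) /\ continuous c2 t /\
    c1 t <> zero /\
    g (c t) (c1 t) (c1 t) = 0 /\
    exists mu : R, forall w : V,
      g (c t) (c2 t) w
      + dirD (fun y => g y (c1 t) w) (c t) (c1 t)
      - / 2 * dirD (fun y => g y (c1 t) (c1 t)) (c t) w
      = mu * g (c t) (c1 t) w.

End Calculus.

Arguments form1 V : clear implicits.
Arguments form2 V : clear implicits.

(** The 3-manifold is an open subset [U] of [R^3]; a line field sends a point
    to the set of vectors of its line. *)

Definition R3 : NormedModule R_AbsRing :=
  prod_NormedModule R_AbsRing
    (prod_NormedModule R_AbsRing R_NormedModule R_NormedModule) R_NormedModule.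

Definition R4 : NormedModule R_AbsRing :=
  prod_NormedModule R_AbsRing R3 R_NormedModule.

Definition line_field : Type := R3 -> R3 -> Prop.

Definition Dplane (L1 L2 : line_field) (x v : R3) : Prop :=
  exists v1 v2, L1 x v1 /\ L2 x v2 /\ v = plus v1 v2.

Definition Dstar (L1 L2 : line_field) (x v : R3) : Prop :=
  Dplane L1 L2 x v /\ ~ L1 x v /\ ~ L2 x v.

Record coframe : Type := Coframe {
  eta1 : form1 R3;
  eta2 : form1 R3;
  eta3 : form1 R3
}.

Record adapted_coframe (U : R3 -> Prop) (L1 L2 : line_field) (eta : coframe)
    : Prop := {
  adapted_form1 : is_form1 U (eta1 eta);
  adapted_form2 : is_form1 U (eta2 eta);
  adapted_form3 : is_form1 U (eta3 eta);
  adapted_free : forall x v, U x ->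
    eta1 eta x v = 0 -> eta2 eta x v = 0 -> eta3 eta x v = 0 -> v = zero;
  adapted_D : forall x v, U x -> (eta3 eta x v = 0 <-> Dplane L1 L2 x v);
  adapted_L2 : forall x v, U x -> L2 x v -> eta1 eta x v = 0;
  adapted_L1 : forall x v, U x -> L1 x v -> eta2 eta x v = 0;
  adapted_d3 : forall x v w, U x ->
    dform (eta3 eta) x v w = wedge (eta1 eta) (eta2 eta) x v w
}.

(** The section [eta] of the principal [R^*]-bundle [B] identifies it with
    [U * R^*]: the point [(x, s)] stands for the coframe
    [(eta1 / s, s * eta2, eta3)] at [x], and [l] in [R^*] acts by
    [(x, s) |-> (x, l * s)]. *)
Definition Bset (U : R3 -> Prop) (b : R4) : Prop := U (fst b) /\ snd b <> 0.

Definition omega1 (eta : coframe) : form1 R4 :=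
  fun b v => eta1 eta (fst b) (fst v) / snd b.
Definition omega2 (eta : coframe) : form1 R4 :=
  fun b v => snd b * eta2 eta (fst b) (fst v).
Definition omega3 (eta : coframe) : form1 R4 :=
  fun b v => eta3 eta (fst b) (fst v).

(** [alpha] is the connection form attached to [eta3 eta], and [K] the
    coefficient of [omega1 /\ omega2] in [d alpha].  The first two equations
    say that [alpha] is a principal connection; in the first one, [(0, s)] is
    the value at [(x, s)] of the generator of the action. *)
Record fefferman_connection (U : R3 -> Prop) (eta : coframe)
    (alpha : form1 R4) (K : R4 -> R) : Prop := {
  connection_form : is_form1 (Bset U) alpha;
  connection_vertical : forall x s, U x -> s <> 0 ->
    alpha (x, s) (zero, s) = 1;
  connection_invariant : forall x s l v r, U x -> s <> 0 -> l <> 0 ->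
    alpha (x, l * s) (v, l * r) = alpha (x, s) (v, r);
  connection_d1 : exists a1 : R4 -> R, forall b v w, Bset U b ->
    dform (omega1 eta) b v w
    = - wedge alpha (omega1 eta) b v w
      + a1 b * wedge (omega2 eta) (omega3 eta) b v w;
  connection_d2 : exists a2 : R4 -> R, forall b v w, Bset U b ->
    dform (omega2 eta) b v w
    = wedge alpha (omega2 eta) b v w
      + a2 b * wedge (omega3 eta) (omega1 eta) b v w;
  connection_d3 : forall b v w, Bset U b ->
    dform (omega3 eta) b v w = wedge (omega1 eta) (omega2 eta) b v w;
  connection_curvature : exists b1 b2 : R4 -> R, forall b v w, Bset U b ->
    dform alpha b v w
    = b1 b * wedge (omega2 eta) (omega3 eta) b v w
      + b2 b * wedge (omega3 eta) (omega1 eta) b v w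
      + K b * wedge (omega1 eta) (omega2 eta) b v w
}.

Definition sigma (eta : coframe) (alpha : form1 R4) (K : R4 -> R) : form1 R4 :=
  fun b v => - (2 / 3) * alpha b v + / 6 * K b * omega3 eta b v.

Definition symprod (w1 w2 : form1 R4) (b v w : R4) : R :=
  / 2 * (w1 b v * w2 b w + w1 b w * w2 b v).

Definition fefferman_metric (eta : coframe) (alpha : form1 R4) (K : R4 -> R)
    (b v w : R4) : R :=
  symprod (omega1 eta) (omega2 eta) b v w
  + symprod (omega3 eta) (sigma eta alpha K) b v w.

(** A point of the ray bundle of [Dstar] over [x] is given by any vector
    spanning it. *)
Definition same_ray (X Y : R3) : Prop := exists k : R, 0 < k /\ X = scal k Y.

Definition h_image (eta : coframe) (b : R4) (X : R3) : Prop :=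
  exists Y : R3, omega1 eta b (Y, 0) = 1 /\ omega2 eta b (Y, 0) = 1 /\
    omega3 eta b (Y, 0) = 0 /\ same_ray X Y.

Definition Jh_image (L1 L2 : line_field) (eta : coframe) (b : R4) (X : R3)
    : Prop :=
  exists X1 X2 : R3, L1 (fst b) X1 /\ L2 (fst b) X2 /\
    h_image eta b (plus X1 X2) /\ same_ray X (minus X1 X2).

(** The curve of rays [t |-> (x t, [X t])] is a null geodesic of the metric
    obtained by transporting the metric of [B] by [h] and by [J o h], whose
    images are disjoint and open. *)
Definition fefferman_null_geodesic (U : R3 -> Prop) (L1 L2 : line_field)
    (eta : coframe) (a b : Rbar) (x X : R -> R3) : Prop :=
  exists (alpha : form1 R4) (K : R4 -> R) (s : R -> R),
    fefferman_connection U eta alpha K /\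
    null_geodesic a b (fefferman_metric eta alpha K)
      (fun t => (x t, s t) : R4) /\
    (forall t : R, Rbar_lt a t -> Rbar_lt t b ->
       Bset U (x t, s t) /\ Dstar L1 L2 (x t) (X t)) /\
    ((forall t : R, Rbar_lt a t -> Rbar_lt t b ->
        h_image eta (x t, s t) (X t)) \/
     (forall t : R, Rbar_lt a t -> Rbar_lt t b ->
        Jh_image L1 L2 eta (x t, s t) (X t))).

(** Chains of [(U, L1, L2)], computed with the representative of the Fefferman
    conformal class given by the contact form [eta3 eta].  Transversality to
    [D] rules out the vertical geodesics. *)
Definition chain (U : R3 -> Prop) (L1 L2 : line_field) (eta : coframe)
    (a b : Rbar) (x : R -> R3) : Prop :=
  adapted_coframe U L1 L2 eta /\
  (exists X : R -> R3, fefferman_null_geodesic U L1 L2 eta a b x X) /\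
  (forall t : R, Rbar_lt a t -> Rbar_lt t b ->
     exists x1 : R3, is_derive x t x1 /\ ~ Dplane L1 L2 (x t) x1).

Definition R2 : NormedModule R_AbsRing :=
  prod_NormedModule R_AbsRing R_NormedModule R_NormedModule.

(** A matrix [(r | h)] is the pair of its columns. *)
Definition mat2 : Type := (R2 * R2)%type.

Definition det2 (r h : R2) : R := fst r * snd h - snd r * fst h.

Definition SL2 (g : mat2) : Prop := det2 (fst g) (snd g) = 1.

Definition mat_id : mat2 := ((1, 0), (0, 1)).

Definition mat_vec (g : mat2) (v : R2) : R2 :=
  plus (scal (fst v) (fst g)) (scal (snd v) (snd g)).

Definition mat_mul (g g' : mat2) : mat2 :=
  (mat_vec g (fst g'), mat_vec g (snd g')).

Definition is_diagonal (g : mat2) : Prop := snd (fst g) = 0 /\ fst (snd g) = 0.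

(** Points of the upper half-plane are complex numbers; [C] is [R * R], so they
    are also pairs [(x, y)]. *)
Definition half_plane (z : C) : Prop := 0 < Im z.

Definition moebius (g : mat2) (z : C) : C :=
  ((RtoC (fst (fst g)) * z + RtoC (fst (snd g)))
   / (RtoC (snd (fst g)) * z + RtoC (snd (snd g))))%C.

Definition hproj (g : mat2) : C := moebius g Ci.

Definition on_hooke_ellipse (z : C) (r : R2) : Prop :=
  fst r ^ 2 - 2 * Re z * fst r * snd r + (Re z ^ 2 + Im z ^ 2) * snd r ^ 2
  = Im z.

Definition on_horocycle (r : R2) (z : C) : Prop :=
  half_plane z /\ on_hooke_ellipse z r.

(** A global chart of [SL_2(R)]: [((x, y), t)] with [(x, y) <> (0, 0)] is sent
    to [(r | h)] with [r = (x, y)] and [h = t r + (-y, x) / |r|^2]. *)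
Definition chart_dom (u : R3) : Prop :=
  0 < fst (fst u) ^ 2 + snd (fst u) ^ 2.

Definition chart (u : R3) : mat2 :=
  let x := fst (fst u) in
  let y := snd (fst u) in
  let t := snd u in
  ((x, y),
   (t * x - y / (x ^ 2 + y ^ 2), t * y + x / (x ^ 2 + y ^ 2))).

Definition tangent_to_fibers (F : R3 -> R * R) : line_field := fun u v =>
  dirD (fun y => fst (F y)) u v = 0 /\ dirD (fun y => snd (F y)) u v = 0.

Definition L_point : line_field := tangent_to_fibers (fun u => fst (chart u)).
Definition L_ellipse : line_field :=
  tangent_to_fibers (fun u => hproj (chart u)).

(** The Maurer-Cartan form [g^-1 dg = ((p, q), (m, -p))] (rows) in the chart:
    [m = det (r, dr)], [p = det (dr, h)], [q = det (dh, h)]. *)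
Definition mc_m : form1 R3 := fun u v =>
  fst (fst u) * snd (fst v) - snd (fst u) * fst (fst v).

Definition mc_p : form1 R3 := fun u v =>
  (fst (fst u) * fst (fst v) + snd (fst u) * snd (fst v))
    / (fst (fst u) ^ 2 + snd (fst u) ^ 2)
  - snd u * mc_m u v.

Definition mc_q : form1 R3 := fun u v =>
  snd v + 2 * snd u * mc_p u v + snd u ^ 2 * mc_m u v
  - mc_m u v / (fst (fst u) ^ 2 + snd (fst u) ^ 2) ^ 2.

Definition horocycle_coframe : coframe := Coframe
  mc_m
  (fun u v => mc_q u v + mc_m u v)
  mc_p.

(** The horocycle path geometry is the dual of that of Hooke ellipses, hence
    the order of the two line fields. *)
Definition horocycle_chain (a b : Rbar) (g : R -> mat2) : Prop :=
  exists u : R -> R3,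
    (forall t : R, Rbar_lt a t -> Rbar_lt t b ->
       chart_dom (u t) /\ chart (u t) = g t) /\
    chain chart_dom L_ellipse L_point horocycle_coframe a b u.

Definition horocycle_quartic (c : R) (z : C) : R :=
  let x := Re z in
  let y := Im z in
  (x ^ 2 + y ^ 2) ^ 2 - (4 * c * x + (c ^ 2 + 4) * y) * (x ^ 2 + y ^ 2)
  + (6 * c ^ 2 - 2) * x ^ 2 + 2 * c ^ 3 * x * y + 6 * y ^ 2
  - 4 * c * (c ^ 2 - 1) * x - (c ^ 4 - 3 * c ^ 2 + 4) * y + (c ^ 2 - 1) ^ 2.

Definition sec (x : R) : R := / cos x.

(** The interval is the connected component of [0] in the set where the
    coefficients [sec (2 tau)] are defined. *)
Definition in_range (tau : R) : Prop := - (PI / 4) < tau < PI / 4.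

Definition chain_solution (c : R) (g : R -> mat2) : Prop :=
  g 0 = mat_id /\
  forall tau, in_range tau ->
    is_derive (fun t => fst (g t)) tau
      (plus (scal (c * sec (2 * tau)) (fst (g tau))) (snd (g tau))) /\
    is_derive (fun t => snd (g t)) tau
      (plus
        (scal (- (1 + c * (c + 2 * sin (2 * tau)) * sec (2 * tau) ^ 2))
           (fst (g tau)))
        (scal (- (c * sec (2 * tau))) (snd (g tau)))).

Definition refl_mat : mat2 := ((- 1, 0), (0, 1)).

(** [refl_mat] is its own inverse. *)
Definition refl_conj (g : mat2) : mat2 :=
  mat_mul (mat_mul refl_mat g) refl_mat.

(* Main.v *)
Require Import Defs.
From Stdlib Require Import Reals Lra.
From Coquelicot Require Import Coquelicot.
Open Scope R_scope.

(** With [g^-1 dg = ((p, q), (m, -p))], [eta1 = m], [eta2 = eta = q + m],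
    [eta3 = p], the connection is [alpha = ds/s - 2 p] with [K = -2], and the
    Fefferman metric is the left-invariant metric
    [m eta + p^2 - (2/3) p ds/s] on [SL_2(R) * R^*].  For a chain put [M = m/p],
    [w = M (q/p + M)].  The geodesic equations give three facts.
    First, [M^3 / s^2] is constant, so [M] vanishes identically or nowhere.
    Second, [M^2 + (1 + w)^2 / 4] is a constant [1 / c^2].  Third, if [M] does
    not vanish and [rho = h + r/M], then [r' = m rho] and [rho' = - m r], while
    [(c M, - c (1 + w) / 2)] turns at twice this speed, so it is
    [(cos 2 tau, sin 2 tau)] where [tau] is the angle of [(r, rho)].  Moving the
    frame at [tau = 0] to [r = (1, 0)], [rho = (c, 1)] gives the explicit chain
    [r = (cos tau + c sin tau, sin tau)].  If [M = 0], the chain is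
    [((k, q), (0, 1/k))] up to [SL_2(R)]; for [q <> 0] its projection lies on
    the parabola [x^2 = q^2 y], which is congruent to the quartic for
    [c = 2]. *)

(** * Derivatives and smooth functions *)

(** Transversality to the contact plane means [p <> 0]. The null condition
    [m (q + m) + p^2 = (2/3) p s'/s] can therefore be solved as [s'/s = (3/2) p (1 + w)], which
    removes the fibre derivative, and passing to the ratios [M = m/p] and [Q = q/p] removes the
    unknown factor [mu] of an arbitrary parametrization. What remains is a closed system for [M] and
    [Q] that drives the frame. It is integrated without any flow: each claim is reduced to a
    function whose derivative vanishes on the interval, be it a conserved quantity, a column of the
    frame rotated back by [tau], or a Wronskian. If [M] and [q] both vanish, the frame is diagonal
    up to [SL_2(R)] and projects into the imaginary axis, a geodesic; this is the first alternative
    in (i). The interval of [tau] ends where [cos (2 tau) = c M] vanishes, so one chain covers only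
    the points of the quartic with [cos (2 tau) > 0]. The points with the opposite sign lie on a
    translate of the chain of parameter [- c], whence the two families in the description of the
    curve. *)

Section Products.
Context {V W : NormedModule R_AbsRing}.

Lemma is_derive_fst (f : R -> prod_NormedModule R_AbsRing V W) t l :
  is_derive f t l -> is_derive (fun s => fst (f s)) t (fst l).
Proof.
  intros H.
  assert (H' := filterdiff_comp f fst _ _ H
                  (filterdiff_linear fst is_linear_fst)).
  exact H'.
Qed.

Lemma is_derive_snd (f : R -> prod_NormedModule R_AbsRing V W) t l :
  is_derive f t l -> is_derive (fun s => snd (f s)) t (snd l).
Proof.
  intros H.
  assert (H' := filterdiff_comp f snd _ _ H
                  (filterdiff_linear snd is_linear_snd)).
  exact H'.
Qed.

Lemma is_derive_pair (f : R -> V) (g : R -> W) t l k :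
  is_derive f t l -> is_derive g t k ->
  is_derive (fun s => (f s, g s) : prod_NormedModule R_AbsRing V W) t (l, k).
Proof.
  intros Hf Hg.
  assert (I1 : is_linear (fun v : V => (v, zero : W))).
  { apply is_linear_prod; [apply is_linear_id | apply is_linear_zero]. }
  assert (I2 : is_linear (fun w : W => (zero : V, w))).
  { apply is_linear_prod; [apply is_linear_zero | apply is_linear_id]. }
  assert (Hf' := filterdiff_comp f _ _ _ Hf (filterdiff_linear _ I1)).
  assert (Hg' := filterdiff_comp g _ _ _ Hg (filterdiff_linear _ I2)).
  assert (H := is_derive_plus (K := R_AbsRing)
    (V := prod_NormedModule R_AbsRing V W)
    (fun s => (f s, zero)) (fun s => (zero, g s)) t (l, zero) (zero, k)).
  assert (E : (l, k) = @plus (prod_NormedModule R_AbsRing V W)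
                         (l, zero) (zero, k)).
  { unfold plus; simpl; unfold prod_plus; simpl.
    now rewrite plus_zero_r, plus_zero_l. }
  rewrite E.
  refine (is_derive_ext _ _ _ _ _ (H _ _)).
  - intros s; unfold plus; simpl; unfold prod_plus; simpl.
    now rewrite plus_zero_r, plus_zero_l.
  - unfold is_derive.
    refine (filterdiff_ext_lin _ _ _ Hf' _).
    intros y; apply (f_equal2 pair); [reflexivity | ].
    symmetry; exact (@scal_zero_r R_AbsRing W y).
  - unfold is_derive.
    refine (filterdiff_ext_lin _ _ _ Hg' _).
    intros y; apply (f_equal2 pair); [ | reflexivity].
    symmetry; exact (@scal_zero_r R_AbsRing V y).
Qed.

End Products.

Lemma continuous_pair {T : UniformSpace} {V W : UniformSpace}
    (f : T -> V) (g : T -> W) x :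
  continuous f x -> continuous g x ->
  continuous (fun s => (f s, g s) : prod_UniformSpace V W) x.
Proof.
  intros Hf Hg.
  apply (continuous_comp_2 f g (fun a b => (a, b)) x Hf Hg).
  intros P [eps HP]; exists eps; intros [y1 y2] Hy; now apply HP.
Qed.

Lemma is_derive_eq {V : NormedModule R_AbsRing} (f : R -> V) t l l' :
  is_derive f t l -> l = l' -> is_derive f t l'.
Proof. now intros H <-. Qed.

Lemma is_derive_eqR (f : R -> R) (t l l' : R) :
  is_derive f t l -> l = l' -> is_derive f t l'.
Proof. apply is_derive_eq. Qed.

Lemma is_derive_unique_val (f : R -> R) t l l' :
  is_derive f t l -> is_derive f t l' -> l = l'.
Proof.
  intros H H'; rewrite <- (is_derive_unique _ _ _ H).
  exact (is_derive_unique _ _ _ H').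
Qed.

Lemma between_in (a b : Rbar) (t1 t2 t : R) :
  Rbar_lt a t1 -> Rbar_lt t2 b -> t1 <= t <= t2 ->
  Rbar_lt a t /\ Rbar_lt t b.
Proof.
  intros H1 H2 [H3 H4]; split.
  - now apply Rbar_lt_le_trans with t1.
  - now apply Rbar_le_lt_trans with t2.
Qed.

Lemma derive_zero_constant {V : NormedModule R_AbsRing} (a b : Rbar)
    (f : R -> V) :
  (forall t : R, Rbar_lt a t -> Rbar_lt t b -> is_derive f t zero) ->
  forall t1 t2 : R, Rbar_lt a t1 -> Rbar_lt t1 b ->
    Rbar_lt a t2 -> Rbar_lt t2 b -> f t1 = f t2.
Proof.
  intros H.
  assert (W : forall t1 t2 : R, Rbar_lt a t1 -> Rbar_lt t2 b -> t1 < t2 ->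
                f t1 = f t2).
  { intros t1 t2 H1 H2 H12; apply eq_is_derive; [ | exact H12].
    intros t Ht; destruct (between_in a b t1 t2 t); auto. }
  intros t1 t2 A1 B1 A2 B2.
  destruct (Rtotal_order t1 t2) as [L | [-> | L]]; auto.
  symmetry; auto.
Qed.

Lemma Rbar_interval_point (a b : Rbar) :
  Rbar_lt a b -> exists t : R, Rbar_lt a t /\ Rbar_lt t b.
Proof.
  destruct a as [a | | ], b as [b | | ]; simpl; intros H; try easy.
  - exists ((a + b) / 2); lra.
  - exists (a + 1); lra.
  - exists (b - 1); lra.
  - exists 0; auto.
Qed.

Section Smoothness.
Context {V : NormedModule R_AbsRing}.
Implicit Types (U : V -> Prop) (f g : V -> R).

Lemma continuous_line (x v : V) :
  continuous (fun t : R => plus x (scal t v)) 0.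
Proof.
  apply (continuous_plus (fun _ : R => x) (fun t : R => scal t v)).
  - apply continuous_const.
  - apply (continuous_scal_l (fun t : R => t)); apply continuous_id.
Qed.

Lemma line_at_0 (x v : V) : plus x (scal 0 v) = x.
Proof.
  replace (scal 0 v) with (zero : V); [apply plus_zero_r | ].
  symmetry; exact (scal_zero_l v).
Qed.

Lemma open_line U x v :
  open U -> U x -> locally 0 (fun t : R => U (plus x (scal t v))).
Proof.
  intros HU Hx; apply (continuous_line x v).
  rewrite line_at_0; now apply HU.
Qed.

(** Openness keeps a short segment through [x] inside [U], so values off [U] do not matter. This is
    what allows forms known only on [Bset] to be differentiated. *)
Lemma dirD_ext U f g x v :
  open U -> U x -> (forall y, U y -> f y = g y) -> dirD f x v = dirD g x v.
Proof.
  intros HU Hx H; apply Derive_ext_loc.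
  refine (filter_imp _ _ _ (open_line U x v HU Hx)); auto.
Qed.

Lemma dirD_is_derive f x v l :
  is_derive (fun t : R => f (plus x (scal t v))) 0 l -> dirD f x v = l.
Proof. apply is_derive_unique. Qed.

Lemma Ck_pred k U f : Ck (S k) U f -> Ck k U f.
Proof.
  revert f; induction k as [ | k IH]; intros f [Hc Hd]; split; auto.
  intros v; destruct (Hd v) as [H1 H2]; split; auto.
Qed.

Lemma Ck_ext k U f g :
  open U -> (forall x, U x -> f x = g x) -> Ck k U f -> Ck k U g.
Proof.
  intros HU; revert f g; induction k as [ | k IH];
    intros f g E [Hc Hd]; split; auto.
  1, 2: intros x Hx; refine (continuous_ext_loc _ _ _ _ (Hc x Hx));
    refine (filter_imp _ _ _ (HU x Hx)); auto.
  intros v; destruct (Hd v) as [H1 H2]; split.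
  - intros x Hx; refine (ex_derive_ext_loc _ _ _ _ (H1 x Hx)).
    refine (filter_imp _ _ _ (open_line U x v HU Hx)); auto.
  - refine (IH _ _ _ H2); intros x Hx; now apply (dirD_ext U).
Qed.

Lemma Ck_const k U (a : R) : open U -> Ck k U (fun _ => a).
Proof.
  intros HU; revert a; induction k as [ | k IH]; intros a; split; auto.
  1, 2: intros x _; apply continuous_const.
  intros v; split.
  - intros x _; apply ex_derive_const.
  - apply (Ck_ext k U (fun _ => 0) _ HU); [ | apply IH].
    intros x _; symmetry; exact (Derive_const a 0).
Qed.

Lemma Ck_linear k U f : open U -> is_linear f -> Ck k U f.
Proof.
  intros HU Hf.
  assert (D : forall x v, is_derive (fun t : R => f (plus x (scal t v))) 0
                            (f v)).
  { intros x v; apply is_derive_ext with (fun t : R => f x + t * f v).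
    - intros t; rewrite (linear_plus f Hf), (linear_scal f Hf); reflexivity.
    - auto_derive; auto; ring. }
  destruct k as [ | k]; split; auto.
  1, 2: intros x _; exact (linear_cont (f : V -> R_NormedModule) x Hf).
  intros v; split.
  - intros x _; exists (f v); apply D.
  - apply (Ck_ext k U (fun _ => f v) _ HU); [ | now apply Ck_const].
    intros x _; symmetry; apply dirD_is_derive, D.
Qed.

Lemma Ck_plus k U f g :
  open U -> Ck k U f -> Ck k U g -> Ck k U (fun x => f x + g x).
Proof.
  intros HU; revert f g; induction k as [ | k IH];
    intros f g [Fc Fd] [Gc Gd]; split; auto.
  1, 2: intros x Hx; apply (continuous_plus f g); auto.
  intros v; destruct (Fd v) as [F1 F2]; destruct (Gd v) as [G1 G2]; split.
  - intros x Hx; apply (ex_derive_plus (fun t : R => f (plus x (scal t v)))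
      (fun t : R => g (plus x (scal t v)))); auto.
  - refine (Ck_ext k U _ _ HU _ (IH _ _ F2 G2)).
    intros x Hx; symmetry; unfold dirD; apply Derive_plus; auto.
Qed.

Lemma Ck_mult k U f g :
  open U -> Ck k U f -> Ck k U g -> Ck k U (fun x => f x * g x).
Proof.
  intros HU; revert f g; induction k as [ | k IH];
    intros f g F G; assert (F' := F); assert (G' := G);
    destruct F as [Fc Fd], G as [Gc Gd]; split; auto.
  1, 2: intros x Hx; apply (continuous_mult (K := R_AbsRing) f g); auto.
  intros v; destruct (Fd v) as [F1 F2]; destruct (Gd v) as [G1 G2]; split.
  - intros x Hx; apply (ex_derive_mult (fun t : R => f (plus x (scal t v)))
      (fun t : R => g (plus x (scal t v)))); auto.
  (* Each summand of the Leibniz rule keeps one factor undifferentiated; [Ck_pred] lowers that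
     factor to class [k]. *)
  - refine (Ck_ext k U _ _ HU _ (Ck_plus k U _ _ HU
      (IH _ _ F2 (Ck_pred k U g G')) (IH _ _ (Ck_pred k U f F') G2))).
    intros x Hx; symmetry; unfold dirD.
    rewrite Derive_mult by auto; now rewrite line_at_0.
Qed.

Lemma Ck_inv k U f :
  open U -> (forall x, U x -> f x <> 0) -> Ck k U f ->
  Ck k U (fun x => / f x).
Proof.
  intros HU Hf; induction k as [ | k IH]; intros F; assert (F' := F);
    destruct F as [Fc Fd]; split; auto.
  1, 2: intros x Hx; apply (continuous_comp f Rinv); auto;
    now apply continuous_Rinv, Hf.
  intros v; destruct (Fd v) as [F1 F2]; split.
  - intros x Hx; apply (ex_derive_inv (fun t : R => f (plus x (scal t v))));
      auto; rewrite line_at_0; auto.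
  (* The derivative [- f' / f^2] is a product of functions of class [k], the factor [/ f] being
     covered by the induction hypothesis for the same [f]. *)
  - assert (I := IH (Ck_pred k U f F')).
    refine (Ck_ext k U (fun x => -1 * dirD f x v * (/ f x * / f x)) _ HU _ _).
    + intros x Hx; symmetry; unfold dirD.
      rewrite Derive_inv; auto; rewrite line_at_0; auto.
      field; auto.
    + repeat apply Ck_mult; auto; now apply Ck_const.
Qed.

Lemma is_linear_Rplus f g :
  is_linear f -> is_linear g -> is_linear (fun v => f v + g v).
Proof.
  intros Hf Hg.
  apply (is_linear_comp (fun v => (f v, g v))
    (fun w : R_NormedModule * R_NormedModule => plus (fst w) (snd w))).
  - now apply is_linear_prod.
  - apply is_linear_plus.
Qed.

Lemma is_linear_Rmult (a : R) f : is_linear f -> is_linear (fun v => a * f v).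
Proof.
  intros Hf.
  exact (is_linear_comp f (fun y : R_NormedModule => a * y) Hf
    (@is_linear_scal_r R_AbsRing R_NormedModule a Rmult_comm)).
Qed.

End Smoothness.

(** * The Maurer-Cartan form *)

(** Differentiates expressions in unknown functions whose derivatives are hypotheses. Such functions
    must be atoms for [auto_derive], hence the [clearbody] before many of its uses. *)
Ltac auto_derive_with :=
  auto_derive;
  [ repeat split; auto; try (eexists; eassumption)
  | repeat match goal with
    | H : is_derive ?f ?x ?l |- context [Derive ?g ?x] =>
        replace (Derive g x) with l
          by (symmetry; apply is_derive_unique; exact H)
    end ].

Definition radius2 (u : R3) : R := fst (fst u) ^ 2 + snd (fst u) ^ 2.

Definition mc_eta (u v : R3) : R := mc_q u v + mc_m u v.

(** [d_m u w v] is the derivative at [u] in the direction [v] of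
    [fun u => mc_m u w]; likewise for the other two. *)
Definition d_m (u w v : R3) : R :=
  fst (fst v) * snd (fst w) - snd (fst v) * fst (fst w).

Definition d_radius2 (u v : R3) : R :=
  2 * fst (fst u) * fst (fst v) + 2 * snd (fst u) * snd (fst v).

Definition d_p (u w v : R3) : R :=
  (fst (fst v) * fst (fst w) + snd (fst v) * snd (fst w)) / radius2 u
  - (fst (fst u) * fst (fst w) + snd (fst u) * snd (fst w))
    * d_radius2 u v / radius2 u ^ 2
  - snd v * mc_m u w - snd u * d_m u w v.

Definition d_q (u w v : R3) : R :=
  2 * snd v * mc_p u w + 2 * snd u * d_p u w v
  + 2 * snd u * snd v * mc_m u w + snd u ^ 2 * d_m u w v
  - d_m u w v / radius2 u ^ 2
  + 2 * mc_m u w * d_radius2 u v / radius2 u ^ 3.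

Lemma is_derive_R3 (u : R -> R3) t u' :
  is_derive u t u' ->
  is_derive (fun s => fst (fst (u s))) t (fst (fst u')) /\
  is_derive (fun s => snd (fst (u s))) t (snd (fst u')) /\
  is_derive (fun s => snd (u s)) t (snd u').
Proof.
  intros H; split; [ | split].
  - exact (is_derive_fst (fun s => fst (u s)) _ _ (is_derive_fst u _ _ H)).
  - exact (is_derive_snd (fun s => fst (u s)) _ _ (is_derive_fst u _ _ H)).
  - exact (is_derive_snd u _ _ H).
Qed.

(** Spelled out in six real functions so that [auto_derive] meets rational expressions. Base point
    and vector both vary: a constant vector gives the directional derivatives, the velocity of a
    curve gives the geodesic equation. *)
Lemma is_derive_mc_coordinates (x y z a b d : R -> R)
    (t x' y' z' a' b' d' : R) :
  is_derive x t x' -> is_derive y t y' -> is_derive z t z' ->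
  is_derive a t a' -> is_derive b t b' -> is_derive d t d' ->
  0 < x t ^ 2 + y t ^ 2 ->
  let u := fun s => ((x s, y s), z s) : R3 in
  let w := fun s => ((a s, b s), d s) : R3 in
  let u' := ((x', y'), z') : R3 in
  let w' := ((a', b'), d') : R3 in
  is_derive (fun s => mc_m (u s) (w s)) t
    (d_m (u t) (w t) u' + mc_m (u t) w') /\
  is_derive (fun s => mc_p (u s) (w s)) t
    (d_p (u t) (w t) u' + mc_p (u t) w') /\
  is_derive (fun s => mc_q (u s) (w s)) t
    (d_q (u t) (w t) u' + mc_q (u t) w').
Proof.
  intros X Y Z A B D N u w u' w'; unfold u, w, u', w';
    clear u w u' w'.
  unfold d_q, mc_q, d_p, mc_p, d_m, mc_m, d_radius2, radius2;
    simpl fst; simpl snd.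
  assert (N' : x t * (x t * 1) + y t * (y t * 1) <> 0)
    by (simpl in N; lra).
  assert (N'' : (x t * (x t * 1) + y t * (y t * 1)) *
       ((x t * (x t * 1) + y t * (y t * 1)) * 1) <> 0)
   by (repeat apply Rmult_integral_contrapositive_currified; lra).
  split; [ | split]; auto_derive_with; field; lra.
Qed.

Lemma is_derive_mc (u w : R -> R3) t u' w' :
  chart_dom (u t) -> is_derive u t u' -> is_derive w t w' ->
  is_derive (fun s => mc_m (u s) (w s)) t
    (d_m (u t) (w t) u' + mc_m (u t) w') /\
  is_derive (fun s => mc_p (u s) (w s)) t
    (d_p (u t) (w t) u' + mc_p (u t) w') /\
  is_derive (fun s => mc_q (u s) (w s)) t
    (d_q (u t) (w t) u' + mc_q (u t) w').
Proof.
  intros N Hu Hw.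
  destruct (is_derive_R3 u t u' Hu) as (U1 & U2 & U3).
  destruct (is_derive_R3 w t w' Hw) as (W1 & W2 & W3).
  exact (is_derive_mc_coordinates _ _ _ _ _ _ t _ _ _ _ _ _
           U1 U2 U3 W1 W2 W3 N).
Qed.

Lemma is_derive_line {V : NormedModule R_AbsRing} (x v : V) :
  is_derive (fun t : R => plus x (scal t v)) 0 v.
Proof.
  apply is_derive_eq with (plus zero (scal one v)).
  - apply (is_derive_plus (fun _ : R => x) (fun t : R => scal t v)).
    + apply is_derive_const.
    + apply (is_derive_scal_l (fun t : R => t)); apply is_derive_id.
  - rewrite plus_zero_l; apply scal_one.
Qed.

Lemma is_derive_mc_line (u w v : R3) :
  chart_dom u ->
  is_derive (fun s => mc_m (plus u (scal s v)) w) 0 (d_m u w v) /\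
  is_derive (fun s => mc_p (plus u (scal s v)) w) 0 (d_p u w v) /\
  is_derive (fun s => mc_q (plus u (scal s v)) w) 0 (d_q u w v).
Proof.
  intros N.
  destruct (is_derive_mc (fun s => plus u (scal s v)) (fun _ => w) 0 v zero)
    as (H1 & H2 & H3).
  - now rewrite line_at_0.
  - apply is_derive_line.
  - apply is_derive_const.
  - rewrite line_at_0 in H1, H2, H3.
    split; [ | split].
    + refine (is_derive_eq _ _ _ _ H1 _).
      unfold mc_m; simpl; unfold zero; simpl; ring.
    + refine (is_derive_eq _ _ _ _ H2 _).
      unfold mc_p at 1, mc_m; simpl; unfold zero; simpl; unfold Rdiv; ring.
    + refine (is_derive_eq _ _ _ _ H3 _).
      unfold mc_q, mc_p, mc_m; simpl; unfold zero; simpl; unfold Rdiv; ring.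
Qed.

(** The tangent vector with prescribed Maurer-Cartan components: the first two entries are
    [dr = p r + m h], and the last one solves the formula of [mc_q] for [dt]. *)
Definition mc_vec (u : R3) (p q m : R) : R3 :=
  let h := snd (chart u) in
  ((p * fst (fst u) + m * fst h, p * snd (fst u) + m * snd h),
   q - 2 * snd u * p - snd u ^ 2 * m + m / radius2 u ^ 2).

Lemma mc_of_vec u p q m :
  chart_dom u ->
  mc_p u (mc_vec u p q m) = p /\ mc_q u (mc_vec u p q m) = q /\
  mc_m u (mc_vec u p q m) = m.
Proof.
  destruct u as [[x y] t]; unfold chart_dom; simpl fst; simpl snd; intros N.
  unfold mc_q, mc_p, mc_m, mc_vec, radius2; simpl fst; simpl snd.
  repeat split; field; lra.
Qed.

Lemma R3_ext (x y z x' y' z' : R) :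
  x = x' -> y = y' -> z = z' -> ((x, y), z) = ((x', y'), z') :> R3.
Proof. now intros -> -> ->. Qed.

Lemma R3_ind (P : R3 -> Prop) :
  (forall x y z : R, P ((x, y), z)) -> forall u, P u.
Proof. intros H [[x y] z]; apply H. Qed.

Lemma vec_of_mc u v :
  chart_dom u -> v = mc_vec u (mc_p u v) (mc_q u v) (mc_m u v).
Proof.
  revert u v; refine (R3_ind _ _); intros x y t.
  refine (R3_ind _ _); intros v1 v2 v3.
  unfold chart_dom; simpl fst; simpl snd; intros N.
  unfold mc_q, mc_p, mc_m, mc_vec, radius2; simpl fst; simpl snd.
  apply R3_ext; field; lra.
Qed.

(** The entries of the Maurer-Cartan equation [d theta = - theta /\ theta] for [theta = g^-1 dg]. *)
Lemma structure_equations u v w :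
  chart_dom u ->
  d_m u w v - d_m u v w = 2 * wedge mc_p mc_m u v w /\
  d_p u w v - d_p u v w = wedge mc_m mc_q u v w /\
  d_q u w v - d_q u v w = - 2 * wedge mc_p mc_q u v w.
Proof.
  destruct u as [[x y] t], v as [[v1 v2] v3], w as [[w1 w2] w3].
  unfold chart_dom, wedge; simpl fst; simpl snd; intros N.
  unfold d_q, mc_q, d_p, mc_p, d_m, mc_m, d_radius2, radius2;
    simpl fst; simpl snd.
  repeat split; field; lra.
Qed.

(** * Regularity of the Maurer-Cartan forms and of the chart *)

Lemma Ck_comp_linear {V W : NormedModule R_AbsRing} k (U : V -> Prop)
    (U' : W -> Prop) (f : V -> R) (l : W -> V) :
  open U' -> is_linear l -> (forall x, U' x -> U (l x)) -> Ck k U f ->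
  Ck k U' (fun x => f (l x)).
Proof.
  intros HO Hl HU; revert f; induction k as [ | k IH]; intros f [Hc Hd];
    split; auto.
  1, 2: intros x Hx; apply (continuous_comp l f); auto; now apply linear_cont.
  intros v; destruct (Hd (l v)) as [H1 H2].
  (* The derivative of [f o l] along [v] is the derivative of [f] along [l v], composed with [l], so
     the induction stays within functions of this shape. *)
  assert (E : forall x t, f (plus (l x) (scal t (l v)))
                          = f (l (plus x (scal t v)))).
  { intros x t; now rewrite (linear_plus l Hl), (linear_scal l Hl). }
  split.
  - intros x Hx; exact (ex_derive_ext _ _ _ (E x) (H1 (l x) (HU x Hx))).
  - refine (Ck_ext k U' _ _ HO _ (IH _ H2)).
    intros x _; apply Derive_ext, E.
Qed.

Lemma is_linear_coordinates :
  is_linear (fun u : R3 => fst (fst u)) /\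
  is_linear (fun u : R3 => snd (fst u)) /\
  is_linear (fun u : R3 => snd u).
Proof.
  assert (L := @is_linear_fst R_AbsRing
    (prod_NormedModule R_AbsRing R_NormedModule R_NormedModule)
    R_NormedModule).
  split; [ | split].
  - refine (is_linear_comp (U := R3) _ _ L _); apply is_linear_fst.
  - refine (is_linear_comp (U := R3) _ _ L _); apply is_linear_snd.
  - exact is_linear_snd.
Qed.

Ltac Ck_arith :=
  lazymatch goal with
  | |- Ck _ _ (fun u => @?f u + @?g u) =>
      refine (Ck_plus _ _ f g _ _ _); [ assumption | Ck_arith | Ck_arith ]
  | |- Ck _ _ (fun u => @?f u * @?g u) =>
      refine (Ck_mult _ _ f g _ _ _); [ assumption | Ck_arith | Ck_arith ]
  | |- _ => first [ solve [auto] | refine (Ck_const _ _ _ _); assumption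
                  | refine (Ck_linear _ _ _ _ _); assumption ]
  end.

Lemma Ck_radius2 k U : open U -> Ck k U radius2.
Proof.
  intros O; destruct is_linear_coordinates as (L1 & L2 & _).
  apply (Ck_ext k _ (fun u : R3 => fst (fst u) * fst (fst u)
                                 + snd (fst u) * snd (fst u)) _ O).
  - intros u _; unfold radius2; simpl; ring.
  - Ck_arith.
Qed.

Lemma open_chart_dom : open chart_dom.
Proof.
  apply (open_comp radius2 (fun r => 0 < r)); [ | apply open_gt].
  intros u _.
  exact (proj1 (Ck_radius2 0 (fun _ => True) open_true) u I).
Qed.

Lemma open_Bset : open (Bset chart_dom).
Proof.
  apply open_and.
  - apply (open_comp (fun b : R4 => fst b) chart_dom);
    [ | apply open_chart_dom].
    intros b _; apply (linear_cont (U := R4) (V := R3)), is_linear_fst.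
  - apply (open_comp (fun b : R4 => snd b) (fun s : R => s <> 0)).
    + intros b _; apply (linear_cont (U := R4) (V := R_NormedModule)),
        is_linear_snd.
    + apply (open_neq 0).
Qed.

Lemma is_linear_mc u : is_linear (mc_m u) /\ is_linear (mc_p u) /\
  is_linear (mc_q u).
Proof.
  destruct is_linear_coordinates as (L1 & L2 & L3).
  assert (M : is_linear (mc_m u)).
  { apply (is_linear_ext (fun v => fst (fst u) * snd (fst v)
                                 + (- snd (fst u)) * fst (fst v))).
    - intros v; unfold mc_m; simpl; ring.
    - apply is_linear_Rplus; now apply is_linear_Rmult. }
  assert (P : is_linear (mc_p u)).
  { apply (is_linear_ext (fun v =>
      (fst (fst u) / radius2 u * fst (fst v)
       + snd (fst u) / radius2 u * snd (fst v)) + (- snd u) * mc_m u v)).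
    - intros v; unfold mc_p, radius2, Rdiv; simpl; ring.
    - repeat apply is_linear_Rplus; now apply is_linear_Rmult. }
  split; [exact M | split; [exact P | ]].
  apply (is_linear_ext (fun v => snd v + (2 * snd u * mc_p u v
    + (snd u ^ 2 - / radius2 u ^ 2) * mc_m u v))).
  - intros v; unfold mc_q, radius2, Rdiv; simpl; ring.
  - repeat apply is_linear_Rplus; try apply is_linear_Rmult; auto.
Qed.

Lemma smooth_mc w :
  smooth chart_dom (fun u => mc_m u w) /\
  smooth chart_dom (fun u => mc_p u w) /\
  smooth chart_dom (fun u => mc_q u w).
Proof.
  destruct is_linear_coordinates as (L1 & L2 & L3).
  assert (O := open_chart_dom).
  assert (M : smooth chart_dom (fun u => mc_m u w)).
  { intros k; apply (Ck_ext k _ (fun u => fst (fst u) * snd (fst w)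
                                + snd (fst u) * (- fst (fst w))) _ O).
    - intros u _; unfold mc_m; simpl; ring.
    - Ck_arith. }
  assert (N : smooth chart_dom (fun u => / radius2 u)).
  { intros k; apply Ck_inv; auto; [ | now apply Ck_radius2].
    unfold chart_dom, radius2; intros u Hu; lra. }
  assert (P : smooth chart_dom (fun u => mc_p u w)).
  { intros k; apply (Ck_ext k _ (fun u =>
      (fst (fst u) * fst (fst w) + snd (fst u) * snd (fst w)) * / radius2 u
      + (-1) * (snd u * mc_m u w)) _ O).
    - intros u _; unfold mc_p, radius2, Rdiv; ring.
    - Ck_arith. }
  split; [exact M | split; [exact P | ]].
  intros k; apply (Ck_ext k _ (fun u =>
      snd w + (2 * (snd u * mc_p u w) + (snd u * snd u
        + (-1) * (/ radius2 u * / radius2 u)) * mc_m u w)) _ O).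
  - intros u Hu; unfold mc_q; unfold chart_dom in Hu.
    fold (radius2 u) in *; field; lra.
  - Ck_arith.
Qed.

Lemma form1_mc :
  is_form1 chart_dom mc_m /\ is_form1 chart_dom mc_p /\
  is_form1 chart_dom (fun u v => mc_q u v + mc_m u v).
Proof.
  split; [ | split]; (split; [intros u _ | intros w]);
    destruct (is_linear_mc u) as (M & P & Q)
    || destruct (smooth_mc w) as (M & P & Q); auto.
  - now apply is_linear_Rplus.
  - intros k; apply Ck_plus; auto; apply open_chart_dom.
Qed.

Lemma chart_det u : chart_dom u -> det2 (fst (chart u)) (snd (chart u)) = 1.
Proof.
  revert u; refine (R3_ind _ _); intros x y t.
  unfold chart_dom, det2; simpl fst; simpl snd; intros N; field; lra.
Qed.

Lemma is_derive_chart_coordinates (x y z : R -> R) (t x' y' z' : R) :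
  is_derive x t x' -> is_derive y t y' -> is_derive z t z' ->
  0 < x t ^ 2 + y t ^ 2 ->
  let u := fun s => ((x s, y s), z s) : R3 in
  let u' := ((x', y'), z') : R3 in
  let p := mc_p (u t) u' in
  let q := mc_q (u t) u' in
  let m := mc_m (u t) u' in
  is_derive (fun s => fst (fst (chart (u s)))) t
    (p * fst (fst (chart (u t))) + m * fst (snd (chart (u t)))) /\
  is_derive (fun s => snd (fst (chart (u s)))) t
    (p * snd (fst (chart (u t))) + m * snd (snd (chart (u t)))) /\
  is_derive (fun s => fst (snd (chart (u s)))) t
    (q * fst (fst (chart (u t))) - p * fst (snd (chart (u t)))) /\
  is_derive (fun s => snd (snd (chart (u s)))) t
    (q * snd (fst (chart (u t))) - p * snd (snd (chart (u t)))).
Proof.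
  intros X Y Z N; unfold mc_q, mc_p, mc_m, chart; cbv zeta;
    simpl fst; simpl snd.
  assert (N' : x t * (x t * 1) + y t * (y t * 1) <> 0)
    by (simpl in N; lra).
  split; [ | split; [ | split]]; auto_derive_with; field; lra.
Qed.

(** [d(r | h) = (r | h) ((p, q), (m, -p))]. *)
Lemma is_derive_chart (u : R -> R3) t u' :
  chart_dom (u t) -> is_derive u t u' ->
  let p := mc_p (u t) u' in
  let q := mc_q (u t) u' in
  let m := mc_m (u t) u' in
  is_derive (fun s => fst (fst (chart (u s)))) t
    (p * fst (fst (chart (u t))) + m * fst (snd (chart (u t)))) /\
  is_derive (fun s => snd (fst (chart (u s)))) t
    (p * snd (fst (chart (u t))) + m * snd (snd (chart (u t)))) /\
  is_derive (fun s => fst (snd (chart (u s)))) t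
    (q * fst (fst (chart (u t))) - p * fst (snd (chart (u t)))) /\
  is_derive (fun s => snd (snd (chart (u s)))) t
    (q * snd (fst (chart (u t))) - p * snd (snd (chart (u t)))).
Proof.
  intros N H; destruct (is_derive_R3 u t u' H) as (X & Y & Z).
  exact (is_derive_chart_coordinates _ _ _ t _ _ _ X Y Z N).
Qed.

(** * The adapted coframe and its connection *)

Lemma hproj_eq (a b c d : R) :
  hproj ((a, c), (b, d))
  = ((a * c + b * d) / (c ^ 2 + d ^ 2), (a * d - c * b) / (c ^ 2 + d ^ 2)).
Proof.
  unfold hproj, moebius; simpl fst; simpl snd.
  replace (RtoC a * Ci + RtoC b)%C with ((b, a) : C)
    by (apply injective_projections; simpl; ring).
  replace (RtoC c * Ci + RtoC d)%C with ((d, c) : C)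
    by (apply injective_projections; simpl; ring).
  unfold Cdiv, Cinv, Cmult; simpl fst; simpl snd; unfold Rdiv.
  replace (d * (d * 1) + c * (c * 1)) with (c ^ 2 + d ^ 2) by ring.
  apply f_equal2; ring.
Qed.

(** By [dr = p r + m h] and the independence of [r] and [h], [dr] vanishes exactly when [p] and [m]
    do; the converse direction below is Cramer's rule. *)
Lemma L_point_iff u v :
  chart_dom u -> L_point u v <-> mc_p u v = 0 /\ mc_m u v = 0.
Proof.
  intros N.
  change (dirD (fun y => fst (fst (chart y))) u v = 0 /\
    dirD (fun y => snd (fst (chart y))) u v = 0 <->
    mc_p u v = 0 /\ mc_m u v = 0).
  destruct (is_derive_chart (fun s => plus u (scal s v)) 0 v) as (H1 & H2 & _).
  1: now rewrite line_at_0.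
  1: apply is_derive_line.
  rewrite line_at_0 in H1, H2.
  rewrite (dirD_is_derive (fun y => fst (fst (chart y))) _ _ _ H1).
  rewrite (dirD_is_derive (fun y => snd (fst (chart y))) _ _ _ H2).
  assert (D := chart_det u N); unfold det2 in D.
  set (a := fst (fst (chart u))) in *; set (b := fst (snd (chart u))) in *.
  set (c := snd (fst (chart u))) in *; set (d := snd (snd (chart u))) in *.
  set (p := mc_p u v); set (m := mc_m u v); clearbody a b c d p m.
  split; [intros [E1 E2] | intros [-> ->]; split; ring].
  split.
  - replace p with (d * (p * a + m * b) - b * (p * c + m * d) +
      p * (1 - (a * d - c * b))) by ring.
    rewrite E1, E2, D; ring.
  - replace m with (a * (p * c + m * d) - c * (p * a + m * b) +
      m * (1 - (a * d - c * b))) by ring.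
    rewrite E1, E2, D; ring.
Qed.

Lemma sum_squares_pos (a b c d : R) : a * d - c * b = 1 -> 0 < c ^ 2 + d ^ 2.
Proof.
  intros H; destruct (Req_dec c 0) as [-> | C].
  - assert (d <> 0) by (intros ->; lra).
    assert (0 < d ^ 2) by now apply pow2_gt_0. lra.
  - assert (0 < c ^ 2) by now apply pow2_gt_0.
    assert (0 <= d ^ 2) by apply pow2_ge_0. lra.
Qed.

(** The derivative of [g i] is [(q + m + 2 p i) / (c i + d)^2], where [(c, d)]
    is the second row of [g]. *)
Lemma is_derive_hproj_coordinates (a b c d : R -> R) (t p q m : R) :
  is_derive a t (p * a t + m * b t) -> is_derive c t (p * c t + m * d t) ->
  is_derive b t (q * a t - p * b t) -> is_derive d t (q * c t - p * d t) ->
  a t * d t - c t * b t = 1 ->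
  is_derive (fun s => fst (hproj ((a s, c s), (b s, d s)))) t
    (((q + m) * (d t ^ 2 - c t ^ 2) + 2 * p * (2 * c t * d t))
     / (c t ^ 2 + d t ^ 2) ^ 2) /\
  is_derive (fun s => snd (hproj ((a s, c s), (b s, d s)))) t
    ((2 * p * (d t ^ 2 - c t ^ 2) - (q + m) * (2 * c t * d t))
     / (c t ^ 2 + d t ^ 2) ^ 2).
Proof.
  intros A C B D E.
  assert (S := sum_squares_pos _ _ _ _ E).
  assert (S' : c t * (c t * 1) + d t * (d t * 1) <> 0) by (simpl in S; lra).
  split.
  - apply (is_derive_ext (fun s => (a s * c s + b s * d s)
                                   / (c s ^ 2 + d s ^ 2))).
    { intros s; now rewrite hproj_eq. }
    auto_derive_with.
    transitivity (((q + m) * (d t ^ 2 - c t ^ 2) + 2 * p * (2 * c t * d t))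
      * (a t * d t - c t * b t) / (c t ^ 2 + d t ^ 2) ^ 2);
      [field; lra | rewrite E; field; lra].
  - apply (is_derive_ext (fun s => (a s * d s - c s * b s)
                                   / (c s ^ 2 + d s ^ 2))).
    { intros s; now rewrite hproj_eq. }
    auto_derive_with.
    transitivity ((2 * p * (d t ^ 2 - c t ^ 2) - (q + m) * (2 * c t * d t))
      * (a t * d t - c t * b t) / (c t ^ 2 + d t ^ 2) ^ 2);
      [field; lra | rewrite E; field; lra].
Qed.

Lemma L_ellipse_iff u v :
  chart_dom u -> L_ellipse u v <-> mc_p u v = 0 /\ mc_eta u v = 0.
Proof.
  intros N.
  change (dirD (fun y => fst (hproj (chart y))) u v = 0 /\
    dirD (fun y => snd (hproj (chart y))) u v = 0 <->
    mc_p u v = 0 /\ mc_eta u v = 0).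
  destruct (is_derive_chart (fun s => plus u (scal s v)) 0 v)
    as (H1 & H2 & H3 & H4).
  1: now rewrite line_at_0.
  1: apply is_derive_line.
  assert (E := chart_det u N); unfold det2 in E.
  destruct (is_derive_hproj_coordinates _ _ _ _ _ _ _ _ H1 H2 H3 H4) as [DR DI].
  1: now rewrite line_at_0.
  rewrite !line_at_0 in DR, DI.
  rewrite (dirD_is_derive (fun y => fst (hproj (chart y))) _ _ _ DR).
  rewrite (dirD_is_derive (fun y => snd (hproj (chart y))) _ _ _ DI).
  clear DR DI H1 H2 H3 H4; unfold mc_eta.
  assert (S := sum_squares_pos _ _ _ _ E).
  set (c := snd (fst (chart u))) in *; set (d := snd (snd (chart u))) in *.
  set (p := mc_p u v); set (q := mc_q u v); set (m := mc_m u v).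
  clearbody c d p q m; clear E.
  (* These are the parts of [k1 + i k2 = (q + m + 2 p i) (d - c i)^2]. Multiplying by [(d + c i)^2]
     recovers [w (q + m + 2 p i)], with [w > 0] the squared norm of that factor's root squared. *)
  set (k1 := (q + m) * (d ^ 2 - c ^ 2) + 2 * p * (2 * c * d)).
  set (k2 := 2 * p * (d ^ 2 - c ^ 2) - (q + m) * (2 * c * d)).
  set (w := (c ^ 2 + d ^ 2) ^ 2).
  assert (W : w <> 0) by (apply pow_nonzero; lra).
  split.
  - intros [K1 K2].
    assert (K1' : k1 = 0).
    { replace k1 with (k1 / w * w) by (field; auto). rewrite K1; ring. }
    assert (K2' : k2 = 0).
    { replace k2 with (k2 / w * w) by (field; auto). rewrite K2; ring. }
    split; apply (Rmult_eq_reg_r w); auto.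
    + replace (p * w) with (/ 2 * ((2 * c * d) * k1
        + (d ^ 2 - c ^ 2) * k2)) by (unfold k1, k2, w; field).
      rewrite K1', K2'; ring.
    + replace ((q + m) * w) with ((d ^ 2 - c ^ 2) * k1
        - (2 * c * d) * k2) by (unfold k1, k2, w; ring).
      rewrite K1', K2'; ring.
  - intros [K1 K2]; unfold k1, k2; rewrite K1, K2; split; field; auto.
Qed.

Lemma Dplane_iff u v :
  chart_dom u -> Dplane L_ellipse L_point u v <-> mc_p u v = 0.
Proof.
  intros N; destruct (is_linear_mc u) as (_ & P & _).
  split.
  - intros (v1 & v2 & H1 & H2 & ->).
    apply L_ellipse_iff in H1; [ | exact N].
    apply L_point_iff in H2; [ | exact N].
    rewrite (linear_plus _ P), (proj1 H1), (proj1 H2); exact (Rplus_0_l 0).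
  - intros H.
    (* The component in [L_ellipse] carries all of [m], and [q + m = 0] there forces [q = - m]; the
       rest, [q + m], goes to [L_point]. *)
    exists (mc_vec u 0 (- mc_m u v) (mc_m u v)).
    exists (mc_vec u 0 (mc_eta u v) 0).
    split; [ | split].
    + apply L_ellipse_iff; [exact N | ]; unfold mc_eta.
      destruct (mc_of_vec u 0 (- mc_m u v) (mc_m u v) N) as (-> & -> & ->).
      split; ring.
    + apply L_point_iff; [exact N | ].
      destruct (mc_of_vec u 0 (mc_eta u v) 0 N) as (-> & _ & ->); auto.
    + transitivity (mc_vec u 0 (mc_q u v) (mc_m u v)).
      { rewrite <- H; now apply vec_of_mc. }
      unfold mc_vec, mc_eta; apply R3_ext; unfold plus; simpl; unfold Rdiv.
      all: ring.
Qed.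

Lemma dform_line (F : Defs.form1 R3) (D : R3 -> R3 -> R3 -> R) u v w :
  (forall w v, is_derive (fun s => F (plus u (scal s v)) w) 0 (D u w v)) ->
  dform F u v w = D u w v - D u v w.
Proof.
  intros H; unfold dform.
  now rewrite (dirD_is_derive _ _ _ _ (H w v)),
    (dirD_is_derive _ _ _ _ (H v w)).
Qed.

Lemma dform_mc u v w :
  chart_dom u ->
  dform mc_m u v w = 2 * wedge mc_p mc_m u v w /\
  dform mc_p u v w = wedge mc_m mc_q u v w /\
  dform mc_q u v w = - 2 * wedge mc_p mc_q u v w.
Proof.
  intros N; destruct (structure_equations u v w N) as (S1 & S2 & S3).
  split; [ | split].
  - rewrite <- S1; apply dform_line; intros; now apply is_derive_mc_line.
  - rewrite <- S2; apply dform_line; intros; now apply is_derive_mc_line.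
  - rewrite <- S3; apply dform_line; intros; now apply is_derive_mc_line.
Qed.

(** Since [m] vanishes on [L_point] and [q + m] on [L_ellipse], the normalization holds because
    [dp = m /\ q = m /\ (q + m)]. *)
Lemma adapted_horocycle_coframe :
  adapted_coframe chart_dom L_ellipse L_point horocycle_coframe.
Proof.
  destruct form1_mc as (M & P & Q).
  constructor; auto; simpl eta1; simpl eta2; simpl eta3.
  - intros u v N H1 H2 H3; rewrite (vec_of_mc u v N), H3, H1.
    replace (mc_q u v) with 0 by lra.
    change (mc_vec u 0 0 0 = ((0, 0), 0)).
    unfold mc_vec; apply R3_ext; simpl; unfold Rdiv; ring.
  - intros u v N; symmetry; now apply Dplane_iff.
  - intros u v N H; now apply L_point_iff in H.
  - intros u v N H; now apply L_ellipse_iff in H.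
  - intros u v w N; rewrite (proj1 (proj2 (dform_mc u v w N))).
    unfold wedge; ring.
Qed.

Definition horocycle_alpha : Defs.form1 R4 :=
  fun b v => snd v / snd b - 2 * mc_p (fst b) (fst v).

Lemma is_derive_affine_combinations (f : R -> R) (l s r k : R) :
  is_derive f 0 l -> s <> 0 ->
  is_derive (fun t => f t / (s + t * r)) 0 (l / s - f 0 * r / s ^ 2) /\
  is_derive (fun t => (s + t * r) * f t) 0 (r * f 0 + s * l) /\
  is_derive (fun t => k / (s + t * r) - 2 * f t) 0 (- k * r / s ^ 2 - 2 * l).
Proof.
  intros F S; assert (S' : s + 0 * r <> 0) by (rewrite Rmult_0_l; lra).
  split; [ | split]; auto_derive_with; rewrite ?Rmult_0_l, ?Rplus_0_r;
    field; auto.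
Qed.

Lemma dirD_on_B (b v : R4) (F : R3 -> R) (l k : R) :
  is_derive (fun t => F (plus (fst b) (scal t (fst v)))) 0 l ->
  snd b <> 0 ->
  dirD (fun y : R4 => F (fst y)) b v = l /\
  dirD (fun y : R4 => F (fst y) / snd y) b v
  = l / snd b - F (fst b) * snd v / snd b ^ 2 /\
  dirD (fun y : R4 => snd y * F (fst y)) b v
  = snd v * F (fst b) + snd b * l /\
  dirD (fun y : R4 => k / snd y - 2 * F (fst y)) b v
  = - k * snd v / snd b ^ 2 - 2 * l.
Proof.
  intros HF Hb.
  destruct (is_derive_affine_combinations _ l (snd b) (snd v) k HF Hb)
    as (H1 & H2 & H3).
  rewrite line_at_0 in H1, H2.
  split; [ | split; [ | split]]; now apply dirD_is_derive.
Qed.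

Lemma is_derive_eta_line u w v :
  chart_dom u ->
  is_derive (fun s => mc_eta (plus u (scal s v)) w) 0 (d_q u w v + d_m u w v).
Proof.
  intros N; destruct (is_derive_mc_line u w v N) as (M & _ & Q).
  exact (is_derive_plus _ _ _ _ _ Q M).
Qed.

Lemma dirD_omega b v w :
  Bset chart_dom b ->
  dirD (fun y => omega1 horocycle_coframe y w) b v
  = d_m (fst b) (fst w) (fst v) / snd b
    - mc_m (fst b) (fst w) * snd v / snd b ^ 2 /\
  dirD (fun y => omega2 horocycle_coframe y w) b v
  = snd v * mc_eta (fst b) (fst w)
    + snd b * (d_q (fst b) (fst w) (fst v) + d_m (fst b) (fst w) (fst v)) /\
  dirD (fun y => omega3 horocycle_coframe y w) b v
  = d_p (fst b) (fst w) (fst v) /\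
  dirD (fun y => horocycle_alpha y w) b v
  = - snd w * snd v / snd b ^ 2 - 2 * d_p (fst b) (fst w) (fst v).
Proof.
  intros [N S]; destruct (is_derive_mc_line _ (fst w) (fst v) N) as (M & P & Q).
  split; [ | split; [ | split]].
  - exact (proj1 (proj2 (dirD_on_B b v (fun u => mc_m u (fst w)) _ 0 M S))).
  - exact (proj1 (proj2 (proj2 (dirD_on_B b v (fun u => mc_eta u (fst w)) _ 0
      (is_derive_eta_line _ _ _ N) S)))).
  - exact (proj1 (dirD_on_B b v (fun u => mc_p u (fst w)) _ 0 P S)).
  - exact (proj2 (proj2 (proj2
      (dirD_on_B b v (fun u => mc_p u (fst w)) _ (snd w) P S)))).
Qed.

Lemma R4_ind (P : R4 -> Prop) :
  (forall (u : R3) (s : R), P (u, s)) -> forall b, P b.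
Proof. intros H [u s]; apply H. Qed.

Ltac split_R4 :=
  refine (R4_ind _ _); intros ?u ?s; refine (R4_ind _ _); intros ?v ?r;
  refine (R4_ind _ _); intros ?w ?k; intros HB.

Lemma dform_omega1 b v w :
  Bset chart_dom b ->
  dform (omega1 horocycle_coframe) b v w
  = - wedge horocycle_alpha (omega1 horocycle_coframe) b v w.
Proof.
  revert b v w; split_R4; unfold dform.
  rewrite (proj1 (dirD_omega _ _ _ HB)), (proj1 (dirD_omega _ _ _ HB)).
  destruct HB as [N S]; simpl fst in *; simpl snd in *.
  destruct (structure_equations _ v w N) as (E & _ & _).
  unfold wedge, horocycle_alpha, omega1 in *; simpl eta1; simpl fst; simpl snd.
  transitivity ((d_m u w v - d_m u v w) / s
    - (mc_m u w * r - mc_m u v * k) / s ^ 2);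
    [field; auto | rewrite E; field; auto].
Qed.

(** From [d (q + m) = - 2 p /\ (q + m) + 4 p /\ m]: the last term is the invariant [a2 = 4 s^2],
    whereas [a1] is zero by [dform_omega1]. *)
Lemma dform_omega2 b v w :
  Bset chart_dom b ->
  dform (omega2 horocycle_coframe) b v w
  = wedge horocycle_alpha (omega2 horocycle_coframe) b v w
    + 4 * snd b ^ 2
      * wedge (omega3 horocycle_coframe) (omega1 horocycle_coframe) b v w.
Proof.
  revert b v w; split_R4; unfold dform.
  rewrite (proj1 (proj2 (dirD_omega _ _ _ HB))).
  rewrite (proj1 (proj2 (dirD_omega _ _ _ HB))).
  destruct HB as [N S]; simpl fst in *; simpl snd in *.
  destruct (structure_equations _ v w N) as (E1 & _ & E2).
  unfold wedge, horocycle_alpha, mc_eta, omega1, omega2, omega3 in *;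
    simpl eta1; simpl eta2; simpl eta3; simpl fst; simpl snd.
  set (x1 := d_q u w v) in *.
  set (x2 := d_q u v w) in *.
  set (y1 := d_m u w v) in *.
  set (y2 := d_m u v w) in *.
  replace x1 with (x2 + (x1 - x2)) by ring.
  replace y1 with (y2 + (y1 - y2)) by ring.
  rewrite E1, E2; field; auto.
Qed.

Lemma dform_omega3 b v w :
  Bset chart_dom b ->
  dform (omega3 horocycle_coframe) b v w
  = wedge (omega1 horocycle_coframe) (omega2 horocycle_coframe) b v w.
Proof.
  revert b v w; split_R4; unfold dform.
  rewrite (proj1 (proj2 (proj2 (dirD_omega _ _ _ HB)))).
  rewrite (proj1 (proj2 (proj2 (dirD_omega _ _ _ HB)))).
  destruct HB as [N S]; simpl fst in *; simpl snd in *.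
  destruct (structure_equations _ v w N) as (_ & E & _).
  rewrite E; unfold wedge, omega1, omega2; simpl eta1; simpl eta2;
    simpl fst; simpl snd; field; auto.
Qed.

Lemma dform_alpha b v w :
  Bset chart_dom b ->
  dform horocycle_alpha b v w
  = - 2 * wedge (omega1 horocycle_coframe) (omega2 horocycle_coframe) b v w.
Proof.
  intros HB; rewrite <- (dform_omega3 b v w HB).
  revert b v w HB; split_R4; unfold dform.
  destruct (dirD_omega (u, s) (v, r) (w, k) HB) as (_ & _ & -> & ->).
  destruct (dirD_omega (u, s) (w, k) (v, r) HB) as (_ & _ & -> & ->).
  simpl fst; simpl snd; field; exact (proj2 HB).
Qed.

Lemma form1_alpha : is_form1 (Bset chart_dom) horocycle_alpha.
Proof.
  assert (L1 : is_linear (fun v : R4 => fst v)) by apply is_linear_fst.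
  assert (L2 : is_linear (fun v : R4 => snd v)) by apply is_linear_snd.
  split.
  - intros b _; destruct (is_linear_mc (fst b)) as (_ & P & _).
    apply (is_linear_ext (fun v : R4 =>
      / snd b * snd v + (-2) * mc_p (fst b) (fst v))).
    { intros v; unfold horocycle_alpha, Rdiv; simpl; ring. }
    apply is_linear_Rplus; apply is_linear_Rmult; auto.
    exact (is_linear_comp _ _ L1 P).
  - intros w k; assert (O := open_Bset).
    apply (Ck_ext k _ (fun b : R4 =>
      / snd b * snd w + (-2) * mc_p (fst b) (fst w)) _ O).
    { intros b _; unfold horocycle_alpha, Rdiv; ring. }
    assert (I : Ck k (Bset chart_dom) (fun b : R4 => / snd b)).
    { apply Ck_inv; auto; [now intros b [] | now apply Ck_linear]. }
    assert (P : Ck k (Bset chart_dom) (fun b : R4 => mc_p (fst b) (fst w))).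
    { apply (Ck_comp_linear k chart_dom _ (fun u => mc_p u (fst w))
               (fun b : R4 => fst b)); auto.
      - now intros b [].
      - apply smooth_mc. }
    Ck_arith.
Qed.

Lemma horocycle_connection :
  fefferman_connection chart_dom horocycle_coframe horocycle_alpha
    (fun _ => - 2).
Proof.
  constructor.
  - exact form1_alpha.
  - intros x s _ S; unfold horocycle_alpha; simpl fst; simpl snd.
    destruct (is_linear_mc x) as (_ & P & _).
    rewrite (linear_zero _ P); unfold zero; simpl; field; auto.
  - intros x s l v r _ S L; unfold horocycle_alpha; simpl; field; auto.
  - exists (fun _ => 0); intros b v w HB; rewrite (dform_omega1 b v w HB); ring.
  - exists (fun b => 4 * snd b ^ 2); intros b v w HB; now apply dform_omega2.
  - exact dform_omega3.
  - exists (fun _ => 0), (fun _ => 0); intros b v w HB.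
    rewrite (dform_alpha b v w HB); ring.
Qed.

Definition dual1 (b : R4) : R4 := (mc_vec (fst b) 0 (- snd b) (snd b), 0).
Definition dual2 (b : R4) : R4 := (mc_vec (fst b) 0 (/ snd b) 0, 0).

Lemma omega_dual b :
  Bset chart_dom b ->
  (omega1 horocycle_coframe b (dual1 b) = 1 /\
   omega2 horocycle_coframe b (dual1 b) = 0 /\
   omega3 horocycle_coframe b (dual1 b) = 0) /\
  (omega1 horocycle_coframe b (dual2 b) = 0 /\
   omega2 horocycle_coframe b (dual2 b) = 1 /\
   omega3 horocycle_coframe b (dual2 b) = 0).
Proof.
  revert b; refine (R4_ind _ _); intros u s [N S]; simpl in N, S.
  destruct (mc_of_vec u 0 (- s) s N) as (P1 & Q1 & M1).
  destruct (mc_of_vec u 0 (/ s) 0 N) as (P2 & Q2 & M2).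
  unfold omega1, omega2, omega3, dual1, dual2; simpl eta1; simpl eta2;
    simpl eta3; simpl fst; simpl snd.
  rewrite P1, Q1, M1, P2, Q2, M2; repeat split; field; auto.
Qed.

(** The definition of a chain quantifies over [alpha] and [K], so they have to be pinned down.
    Evaluating the first two structure equations on the vectors dual to [omega1] and [omega2] kills
    the unknown [a1], [a2] and shows that the difference of two connections is a multiple both of
    [omega1] and of [omega2], hence zero. The function [K] is the value of [d alpha] on the two dual
    vectors. *)
Lemma connection_unique alpha K :
  fefferman_connection chart_dom horocycle_coframe alpha K ->
  forall b, Bset chart_dom b ->
    (forall v, alpha b v = horocycle_alpha b v) /\ K b = - 2.
Proof.
  intros HC.
  assert (A : forall b, Bset chart_dom b ->
                forall v, alpha b v = horocycle_alpha b v).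
  { intros b HB.
    destruct (connection_d1 _ _ _ _ HC) as [a1 D1].
    destruct (connection_d2 _ _ _ _ HC) as [a2 D2].
    destruct (omega_dual b HB) as ((X1 & X2 & X3) & (Y1 & Y2 & Y3)).
    set (delta := fun v => alpha b v - horocycle_alpha b v).
    assert (E1 : forall w, delta w = delta (dual1 b)
                   * omega1 horocycle_coframe b w).
    { intros w; assert (E := D1 b (dual1 b) w HB).
      rewrite dform_omega1 in E by exact HB.
      unfold delta, wedge in *; rewrite X1, X2, X3 in E; lra. }
    assert (E2 : forall w, delta w = delta (dual2 b)
                   * omega2 horocycle_coframe b w).
    { intros w; assert (E := D2 b (dual2 b) w HB).
      rewrite dform_omega2 in E by exact HB.
      unfold delta, wedge in *; rewrite Y1, Y2, Y3 in E; lra. }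
    intros v; apply Rminus_diag_uniq; fold (delta v).
    rewrite E1, (E2 (dual1 b)), X2; ring. }
  intros b HB; split; [now apply A | ].
  destruct (connection_curvature _ _ _ _ HC) as (b1 & b2 & D).
  destruct (omega_dual b HB) as ((X1 & X2 & X3) & (Y1 & Y2 & Y3)).
  assert (E := D b (dual1 b) (dual2 b) HB).
  assert (E' : dform alpha b (dual1 b) (dual2 b)
               = dform horocycle_alpha b (dual1 b) (dual2 b)).
  { unfold dform; apply f_equal2;
      apply (dirD_ext (Bset chart_dom)); auto using open_Bset. }
  rewrite E', dform_alpha in E by exact HB; unfold wedge in E.
  rewrite X1, X2, X3, Y1, Y2, Y3 in E; lra.
Qed.

(** * Null geodesics of the Fefferman metric *)

Definition horocycle_metric (b v w : R4) : R :=
  / 2 * (mc_m (fst b) (fst v) * mc_eta (fst b) (fst w)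
         + mc_m (fst b) (fst w) * mc_eta (fst b) (fst v))
  + mc_p (fst b) (fst v) * mc_p (fst b) (fst w)
  - / 3 * (mc_p (fst b) (fst v) * snd w / snd b
           + mc_p (fst b) (fst w) * snd v / snd b).

(** Here [sigma = p - (2/3) ds/s]: the coefficient of [p] is [4/3] from [alpha] and [- 1/3] from
    [K = - 2]. *)
Lemma fefferman_metric_eq alpha K b v w :
  fefferman_connection chart_dom horocycle_coframe alpha K ->
  Bset chart_dom b ->
  fefferman_metric horocycle_coframe alpha K b v w = horocycle_metric b v w.
Proof.
  intros HC HB; destruct (connection_unique alpha K HC b HB) as [HA HK].
  unfold fefferman_metric, symprod, Defs.sigma; cbv beta.
  rewrite !HA, HK; clear HC HA HK.
  revert b v w HB; split_R4; destruct HB as [_ S]; simpl in S.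
  unfold horocycle_metric, horocycle_alpha, omega1, omega2, omega3, mc_eta;
    simpl eta1; simpl eta2; simpl eta3; simpl fst; simpl snd.
  field; auto.
Qed.

Definition d_eta (u w v : R3) : R := d_q u w v + d_m u w v.

Lemma is_derive_metric_coordinates (m1 m2 e1 e2 p1 p2 : R -> R)
    (dm1 dm2 de1 de2 dp1 dp2 r k s l : R) :
  is_derive m1 0 dm1 -> is_derive m2 0 dm2 -> is_derive e1 0 de1 ->
  is_derive e2 0 de2 -> is_derive p1 0 dp1 -> is_derive p2 0 dp2 ->
  s <> 0 ->
  is_derive (fun t => / 2 * (m1 t * e2 t + m2 t * e1 t) + p1 t * p2 t
    - / 3 * (p1 t * k / (s + t * l) + p2 t * r / (s + t * l))) 0
    (/ 2 * (dm1 * e2 0 + m1 0 * de2 + dm2 * e1 0 + m2 0 * de1)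
     + dp1 * p2 0 + p1 0 * dp2
     - / 3 * (dp1 * k / s + dp2 * r / s
              - (p1 0 * k + p2 0 * r) * l / s ^ 2)).
Proof.
  intros; assert (s + 0 * l <> 0) by (rewrite Rmult_0_l; lra).
  auto_derive_with; rewrite ?Rmult_0_l, ?Rplus_0_r; field; auto.
Qed.

Lemma dirD_metric b v w z :
  Bset chart_dom b ->
  dirD (fun y => horocycle_metric y v w) b z
  = / 2 * (d_m (fst b) (fst v) (fst z) * mc_eta (fst b) (fst w)
           + mc_m (fst b) (fst v) * d_eta (fst b) (fst w) (fst z)
           + d_m (fst b) (fst w) (fst z) * mc_eta (fst b) (fst v)
           + mc_m (fst b) (fst w) * d_eta (fst b) (fst v) (fst z))
    + d_p (fst b) (fst v) (fst z) * mc_p (fst b) (fst w)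
    + mc_p (fst b) (fst v) * d_p (fst b) (fst w) (fst z)
    - / 3 * (d_p (fst b) (fst v) (fst z) * snd w / snd b
             + d_p (fst b) (fst w) (fst z) * snd v / snd b
             - (mc_p (fst b) (fst v) * snd w + mc_p (fst b) (fst w) * snd v)
               * snd z / snd b ^ 2).
Proof.
  intros [N S].
  destruct (is_derive_mc_line _ (fst v) (fst z) N) as (M1 & P1 & _).
  destruct (is_derive_mc_line _ (fst w) (fst z) N) as (M2 & P2 & _).
  assert (E1 := is_derive_eta_line _ (fst v) (fst z) N).
  assert (E2 := is_derive_eta_line _ (fst w) (fst z) N).
  assert (H := is_derive_metric_coordinates _ _ _ _ _ _ _ _ _ _ _ _
    (snd v) (snd w) (snd b) (snd z) M1 M2 E1 E2 P1 P2 S).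
  cbv beta in H; rewrite !line_at_0 in H; exact (dirD_is_derive _ _ _ _ H).
Qed.

Definition lowered_geodesic (g : R4 -> R4 -> R4 -> R) (b b1 b2 w : R4) : R :=
  g b b2 w + dirD (fun y => g y b1 w) b b1
  - / 2 * dirD (fun y => g y b1 b1) b w.

(** The Euler-Poincare equations of the left-invariant metric: with
    [A = p - v / 3], [v = s' / s], the momentum is
    [A p + 1/2 m q + 1/2 (q + 2 m) m - 1/3 p v]. *)
Lemma lowered_geodesic_eq u s x1 s1 x2 s2 w k :
  Bset chart_dom (u, s) ->
  let m := mc_m u x1 in let p := mc_p u x1 in let q := mc_q u x1 in
  let v := s1 / s in
  let m' := d_m u x1 x1 + mc_m u x2 in
  let p' := d_p u x1 x1 + mc_p u x2 in
  let q' := d_q u x1 x1 + mc_q u x2 in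
  let v' := s2 / s - v ^ 2 in
  lowered_geodesic horocycle_metric (u, s) (x1, s1) (x2, s2) (w, k)
  = (p' - v' / 3 - 2 * m ^ 2) * mc_p u w
    + / 2 * (m' - 2 / 3 * m * v) * mc_q u w
    + / 2 * (q' + 2 * m'
             - 2 * ((p - v / 3) * q - p * (q + 2 * m))) * mc_m u w
    - / 3 * p' * (k / s).
Proof.
  intros HB; cbv zeta; unfold lowered_geodesic.
  rewrite !dirD_metric by exact HB; destruct HB as [N S]; simpl in N, S.
  unfold horocycle_metric, d_eta, mc_eta; simpl fst; simpl snd.
  destruct (structure_equations u x1 w N) as (E1 & E2 & E3).
  unfold wedge in *.
  set (a1 := d_m u w x1) in *; set (a2 := d_m u x1 w) in *.
  set (b1 := d_p u w x1) in *; set (b2 := d_p u x1 w) in *.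
  set (c1 := d_q u w x1) in *; set (c2 := d_q u x1 w) in *.
  (* After this substitution the derivatives of the forms in the direction [w] cancel, and only the
     structure constants survive. *)
  replace a1 with (a2 + (a1 - a2)) by ring.
  replace b1 with (b2 + (b1 - b2)) by ring.
  replace c1 with (c2 + (c1 - c2)) by ring.
  rewrite E1, E2, E3; field; auto.
Qed.

(** The two metrics agree on [Bset] only; as this set is open, their directional derivatives agree
    there too. *)
Lemma null_geodesic_horocycle (a b : Rbar) alpha K (c : R -> R4) :
  fefferman_connection chart_dom horocycle_coframe alpha K ->
  (forall t : R, Rbar_lt a t -> Rbar_lt t b -> Bset chart_dom (c t)) ->
  null_geodesic a b (fefferman_metric horocycle_coframe alpha K) c <->
  null_geodesic a b horocycle_metric c.
Proof.
  intros HC HB.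
  assert (E : forall y v w, Bset chart_dom y ->
    fefferman_metric horocycle_coframe alpha K y v w = horocycle_metric y v w).
  { intros; now apply fefferman_metric_eq. }
  assert (D : forall y v w z, Bset chart_dom y ->
    dirD (fun y => fefferman_metric horocycle_coframe alpha K y v w) y z
    = dirD (fun y => horocycle_metric y v w) y z).
  { intros; apply (dirD_ext (Bset chart_dom)); auto using open_Bset. }
  split; intros (c1 & c2 & H); exists c1, c2; intros t Ha Hb;
    destruct (H t Ha Hb) as (H1 & H2 & H3 & H4 & H5 & mu & H6);
    assert (B := HB t Ha Hb); repeat (split; [assumption | ]).
  - rewrite <- E by exact B; split; [exact H5 | exists mu; intros w].
    rewrite <- !E, <- !D by exact B; apply H6.
  - rewrite E by exact B; split; [exact H5 | exists mu; intros w].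
    rewrite !E, !D by exact B; apply H6.
Qed.

Lemma mc_zero u : mc_m u zero = 0 /\ mc_p u zero = 0 /\ mc_q u zero = 0.
Proof.
  destruct (is_linear_mc u) as (M & P & Q).
  split; [ | split]; now apply (linear_zero (V := R_NormedModule)).
Qed.

Lemma null_geodesic_equations u s x1 s1 x2 s2 mu :
  Bset chart_dom (u, s) ->
  horocycle_metric (u, s) (x1, s1) (x1, s1) = 0 ->
  (forall w, lowered_geodesic horocycle_metric (u, s) (x1, s1) (x2, s2) w
             = mu * horocycle_metric (u, s) (x1, s1) w) ->
  let m := mc_m u x1 in let p := mc_p u x1 in let q := mc_q u x1 in
  let v := s1 / s in
  m * (q + m) + p ^ 2 = 2 / 3 * p * v /\
  d_p u x1 x1 + mc_p u x2 = mu * p /\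
  d_m u x1 x1 + mc_m u x2 = mu * m + 2 / 3 * m * v /\
  d_q u x1 x1 + mc_q u x2
  = mu * q - 4 / 3 * m * v + 2 * ((p - v / 3) * q - p * (q + 2 * m)).
Proof.
  intros HB H0 H; cbv zeta; destruct (mc_zero u) as (Z1 & Z2 & Z3).
  assert (N := proj1 HB); assert (S := proj2 HB); simpl in N, S.
  (* The generator of the fibre gives the equation for [p']; the frame vectors with [q = 1] and with
     [m = 1] give those for [m'] and [q']. *)
  assert (Hs := H (zero, s)).
  assert (Hq := H (mc_vec u 0 1 0, 0)).
  assert (Hm := H (mc_vec u 0 0 1, 0)).
  rewrite lowered_geodesic_eq in Hs, Hq, Hm by exact HB.
  destruct (mc_of_vec u 0 1 0 N) as (A1 & A2 & A3).
  destruct (mc_of_vec u 0 0 1 N) as (B1 & B2 & B3).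
  unfold horocycle_metric, mc_eta in H0, Hs, Hq, Hm; simpl fst in *;
    simpl snd in *.
  rewrite Z1, Z2, Z3 in Hs; rewrite A1, A2, A3 in Hq; rewrite B1, B2, B3 in Hm.
  replace (s / s) with 1 in Hs by (field; auto).
  replace (mc_p u x1 * s / s) with (mc_p u x1) in Hs by (field; auto).
  unfold Rdiv in *; repeat split; lra.
Qed.

Lemma is_derive_R3_unique (u : R -> R3) t v w :
  is_derive u t v -> is_derive u t w -> v = w.
Proof.
  intros Hv Hw.
  destruct (is_derive_R3 _ _ _ Hv) as (V1 & V2 & V3).
  destruct (is_derive_R3 _ _ _ Hw) as (W1 & W2 & W3).
  destruct v as [[v1 v2] v3], w as [[w1 w2] w3]; apply R3_ext.
  - exact (is_derive_unique_val _ _ _ _ V1 W1).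
  - exact (is_derive_unique_val _ _ _ _ V2 W2).
  - exact (is_derive_unique_val _ _ _ _ V3 W3).
Qed.

Lemma chain_equations (a b : Rbar) (g : R -> mat2) :
  horocycle_chain a b g ->
  exists r1 r2 h1 h2 p M Q s : R -> R,
    forall t : R, Rbar_lt a t -> Rbar_lt t b ->
      g t = ((r1 t, r2 t), (h1 t, h2 t)) /\
      r1 t * h2 t - r2 t * h1 t = 1 /\ p t <> 0 /\ s t <> 0 /\
      is_derive r1 t (p t * (r1 t + M t * h1 t)) /\
      is_derive r2 t (p t * (r2 t + M t * h2 t)) /\
      is_derive h1 t (p t * (Q t * r1 t - h1 t)) /\
      is_derive h2 t (p t * (Q t * r2 t - h2 t)) /\
      is_derive s t (3 / 2 * p t * (1 + M t * (Q t + M t)) * s t) /\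
      is_derive M t (p t * (M t * (1 + M t * (Q t + M t)))) /\
      is_derive Q t (p t * (- (1 + M t * (Q t + M t)) * Q t - 6 * M t
                            - 2 * M t * (M t * (Q t + M t)))).
Proof.
  intros (x & Hx & _ & (X & alpha & K & s & HC & HN & HB & _) & HD).
  assert (HB' : forall t : R, Rbar_lt a t -> Rbar_lt t b ->
                  Bset chart_dom (x t, s t)) by (intros t A B; now apply HB).
  clear HB; apply (null_geodesic_horocycle a b alpha K _ HC HB') in HN.
  destruct HN as (c1 & c2 & HN).
  set (x1 := fun t => fst (c1 t) : R3).
  set (m := fun t => mc_m (x t) (x1 t)).
  set (p := fun t => mc_p (x t) (x1 t)).
  set (q := fun t => mc_q (x t) (x1 t)).
  exists (fun t => fst (fst (chart (x t)))), (fun t => snd (fst (chart (x t)))),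
    (fun t => fst (snd (chart (x t)))), (fun t => snd (snd (chart (x t)))),
    p, (fun t => m t / p t), (fun t => q t / p t), s.
  intros t A B; destruct (HN t A B) as (D1 & D2 & _ & _ & H0 & mu & H).
  destruct (Hx t A B) as [N G]; assert (HBt := HB' t A B).
  assert (S := proj2 HBt); simpl in S.
  assert (Dx := is_derive_fst _ _ _ D1).
  change (is_derive x t (x1 t)) in Dx.
  assert (Ds := is_derive_snd _ _ _ D1).
  change (is_derive s t (snd (c1 t))) in Ds.
  assert (Dx1 := is_derive_fst _ _ _ D2).
  change (is_derive x1 t (fst (c2 t))) in Dx1.
  assert (Pt : p t <> 0).
  { destruct (HD t A B) as (y & Dy & NP); intros P0; apply NP.
    apply Dplane_iff; [exact N | ].
    assert (Ey : y = x1 t).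
    { exact (is_derive_R3_unique _ _ _ _ Dy Dx). }
    now rewrite Ey. }
  rewrite (surjective_pairing (c1 t)) in H0.
  assert (H' : forall w, lowered_geodesic horocycle_metric (x t, s t)
      (x1 t, snd (c1 t)) (fst (c2 t), snd (c2 t)) w
      = mu * horocycle_metric (x t, s t) (x1 t, snd (c1 t)) w).
  { intros w; unfold x1; rewrite <- !surjective_pairing; apply H. }
  destruct (null_geodesic_equations (x t) (s t) (x1 t) (snd (c1 t))
      (fst (c2 t)) (snd (c2 t)) mu HBt H0 H')
    as (E0 & Ep & Em & Eq).
  destruct (is_derive_mc x x1 t _ _ N Dx Dx1) as (Dm & Dp & Dq).
  rewrite Em in Dm; rewrite Ep in Dp; rewrite Eq in Dq.
  change (fun s => mc_m (x s) (x1 s)) with m in Dm.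
  change (fun s => mc_p (x s) (x1 s)) with p in Dp.
  change (fun s => mc_q (x s) (x1 s)) with q in Dq.
  destruct (is_derive_chart x t _ N Dx) as (C1 & C2 & C3 & C4).
  change (mc_m (x t) (x1 t)) with (m t) in *.
  change (mc_p (x t) (x1 t)) with (p t) in *.
  change (mc_q (x t) (x1 t)) with (q t) in *.
  set (s1 := snd (c1 t)) in *.
  (* The null condition solved for [s'/s]. *)
  assert (Ev : s1 / s t = 3 / 2 * (m t * (q t + m t) + p t ^ 2) / p t).
  { rewrite E0; field; auto. }
  rewrite Ev in Dm, Dq.
  clearbody m p q; clear - G N Pt S C1 C2 C3 C4 Ds Dm Dp Dq Ev.
  split; [rewrite <- G, <- !surjective_pairing; reflexivity | ].
  split; [exact (chart_det _ N) | split; [exact Pt | split; [exact S | ]]].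
  split; [refine (is_derive_eqR _ _ _ _ C1 _); field; auto | ].
  split; [refine (is_derive_eqR _ _ _ _ C2 _); field; auto | ].
  split; [refine (is_derive_eqR _ _ _ _ C3 _); field; auto | ].
  split; [refine (is_derive_eqR _ _ _ _ C4 _); field; auto | ].
  split.
  { refine (is_derive_eqR _ _ _ _ Ds _).
    replace s1 with (s1 / s t * s t) by (field; auto).
    rewrite Ev; field; auto. }
  split; auto_derive_with; field; auto.
Qed.

(** * The quartic *)

Lemma mat_ext (a b c d a' b' c' d' : R) :
  a = a' -> b = b' -> c = c' -> d = d' ->
  ((a, c), (b, d)) = ((a', c'), (b', d')) :> mat2.
Proof. now intros -> -> -> ->. Qed.

Lemma mat2_ind (P : mat2 -> Prop) :
  (forall a b c d : R, P ((a, c), (b, d))) -> forall k, P k.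
Proof. intros H [[a c] [b d]]; apply H. Qed.

Lemma mat_mul_eq (a b c d a' b' c' d' : R) :
  mat_mul ((a, c), (b, d)) ((a', c'), (b', d'))
  = ((a * a' + b * c', c * a' + d * c'), (a * b' + b * d', c * b' + d * d')).
Proof.
  change (((a' * a + c' * b, a' * c + c' * d),
           (b' * a + d' * b, b' * c + d' * d))
    = ((a * a' + b * c', c * a' + d * c'), (a * b' + b * d', c * b' + d * d'))
    :> mat2).
  apply mat_ext; ring.
Qed.

Lemma mat_mul_assoc (g1 g2 g3 : mat2) :
  mat_mul (mat_mul g1 g2) g3 = mat_mul g1 (mat_mul g2 g3).
Proof.
  destruct g1 as [[a1 c1] [b1 d1]], g2 as [[a2 c2] [b2 d2]],
    g3 as [[a3 c3] [b3 d3]].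
  rewrite !mat_mul_eq; apply mat_ext; ring.
Qed.

Lemma SL2_mul (g1 g2 : mat2) : SL2 g1 -> SL2 g2 -> SL2 (mat_mul g1 g2).
Proof.
  destruct g1 as [[a1 c1] [b1 d1]], g2 as [[a2 c2] [b2 d2]].
  rewrite mat_mul_eq; unfold SL2, det2; cbn [fst snd]; intros H1 H2.
  transitivity ((a1 * d1 - c1 * b1) * (a2 * d2 - c2 * b2));
    [ring | rewrite H1, H2; ring].
Qed.

Lemma hproj_Im_pos (a b c d : R) :
  a * d - c * b = 1 -> half_plane (hproj ((a, c), (b, d))).
Proof.
  intros D; unfold half_plane; rewrite hproj_eq; cbn [snd]; rewrite D.
  apply Rdiv_lt_0_compat; [lra | ].
  now apply (sum_squares_pos a b).
Qed.

Definition gram_quadric (c A B D : R) : R :=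
  (A - 2 * c * B + (c ^ 2 - 1) * D) ^ 2 - (c ^ 2 + 4) * A + 2 * c ^ 3 * B
  - (c ^ 4 - 3 * c ^ 2 + 4) * D + 8 - 2 * c ^ 2.

(** In terms of the Gram matrix [((A, B), (B, D))] of the rows of [g], of
    determinant [1], the point [g i] is [(B + i) / D], and the quartic becomes a
    quadric. *)
Lemma quartic_gram (k a b c d : R) :
  a * d - c * b = 1 ->
  horocycle_quartic k (hproj ((a, c), (b, d))) = 0 <->
  gram_quadric k (a ^ 2 + b ^ 2) (a * c + b * d) (c ^ 2 + d ^ 2) = 0.
Proof.
  intros H; assert (P := sum_squares_pos _ _ _ _ H).
  assert (L : (a ^ 2 + b ^ 2) * (c ^ 2 + d ^ 2) = (a * c + b * d) ^ 2 + 1).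
  { replace 1 with ((a * d - c * b) ^ 2) by (rewrite H; ring); ring. }
  rewrite hproj_eq, H.
  set (A := a ^ 2 + b ^ 2) in *; set (B := a * c + b * d) in *.
  set (D := c ^ 2 + d ^ 2) in *; clearbody A B D.
  unfold horocycle_quartic, Re, Im; cbv zeta; cbn [fst snd].
  assert (HA : A = (B ^ 2 + 1) / D) by (rewrite <- L; field; lra).
  match goal with |- ?q = 0 <-> _ =>
    assert (E : q * D ^ 2 = gram_quadric k A B D)
      by (unfold gram_quadric; rewrite HA; field; lra) end.
  split; intros Z.
  - now rewrite <- E, Z, Rmult_0_l.
  - apply (Rmult_eq_reg_r (D ^ 2)); [ | apply pow_nonzero; lra].
    now rewrite E, Z, Rmult_0_l.
Qed.

(** The chain of parameter [c] at [tau], where [x = cos tau], [y = sin tau]. *)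
Definition chain_mat (c x y : R) : mat2 :=
  let e := c / (x ^ 2 - y ^ 2) in
  ((x + c * y, y), (c * x - y - e * (x + c * y), x - e * y)).

Lemma chain_mat_det (c x y : R) :
  x ^ 2 + y ^ 2 = 1 -> SL2 (chain_mat c x y).
Proof.
  intros H; unfold SL2, det2, chain_mat; cbn [fst snd].
  rewrite <- H; ring.
Qed.

(** With [C = cos (2 tau)], [S = sin (2 tau)], [e = c / C]. *)
Lemma chain_mat_gram (c x y : R) :
  x ^ 2 + y ^ 2 = 1 -> x ^ 2 - y ^ 2 <> 0 ->
  let C := x ^ 2 - y ^ 2 in let S := 2 * x * y in let e := c / C in
  let D := 1 - e * S + e ^ 2 * (1 - C) / 2 in
  let b := - c + e ^ 2 * S / 2 in
  let a := 1 + e * S + e ^ 2 * (1 + C) / 2 in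
  let g := chain_mat c x y in
  fst (fst g) ^ 2 + fst (snd g) ^ 2 = a + 2 * c * b + c ^ 2 * D /\
  fst (fst g) * snd (fst g) + fst (snd g) * snd (snd g) = b + c * D /\
  snd (fst g) ^ 2 + snd (snd g) ^ 2 = D.
Proof.
  intros H HC; cbv zeta; unfold chain_mat; cbn [fst snd].
  set (C := x ^ 2 - y ^ 2) in *.
  assert (X : (1 + C) / 2 = x ^ 2) by (unfold C; lra).
  assert (Y : (1 - C) / 2 = y ^ 2) by (unfold C; lra).
  replace ((c / C) ^ 2 * (1 + C) / 2) with ((c / C) ^ 2 * ((1 + C) / 2))
    by (field; auto).
  replace ((c / C) ^ 2 * (1 - C) / 2) with ((c / C) ^ 2 * ((1 - C) / 2))
    by (field; auto).
  rewrite X, Y.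
  set (e := c / C); assert (E : c = e * (x ^ 2 - y ^ 2))
    by (unfold e; fold C; field; auto).
  clearbody e; clear X Y C HC.
  (* With [c] eliminated through [e] and [1] replaced by [x^2 + y^2], the three claims are
     polynomial identities in [e], [x], [y]. *)
  rewrite <- H; repeat split; [ | | ring].
  - rewrite E; field.
  - rewrite E; field.
Qed.

(** On the Gram entries of [chain_mat] the quadric is a multiple of [C^2 + S^2 - 1], with
    [C = x^2 - y^2] and [S = 2 x y]; the quartic thus expresses the circle relation of the double
    angle. *)
Lemma chain_mat_quartic (c x y : R) :
  x ^ 2 + y ^ 2 = 1 -> x ^ 2 - y ^ 2 <> 0 ->
  half_plane (hproj (chain_mat c x y)) /\
  horocycle_quartic c (hproj (chain_mat c x y)) = 0.
Proof.
  intros H HC; assert (D := chain_mat_det c x y H).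
  destruct (chain_mat_gram c x y H HC) as (E1 & E2 & E3).
  unfold SL2, det2 in D; unfold chain_mat in *; cbn [fst snd] in *.
  split; [now apply hproj_Im_pos | ].
  apply quartic_gram; [exact D | rewrite E1, E2, E3].
  set (C := x ^ 2 - y ^ 2) in *.
  set (e := c / C); assert (E : c = e * C) by (unfold e; field; auto).
  unfold gram_quadric; clearbody e; rewrite E.
  transitivity (4 * e ^ 2 * (C ^ 2 + (2 * x * y) ^ 2 - 1)); [field | ].
  replace (C ^ 2 + (2 * x * y) ^ 2) with ((x ^ 2 + y ^ 2) ^ 2)
    by (unfold C; ring).
  rewrite H; ring.
Qed.

(** The first matrix acts by [z |-> (4 z - 3 q^2) / (4 z - q^2)]. It takes the ideal points [0] and
    infinity of the parabola [x^2 = q^2 y] to [3] and [1], where the quartic of [c = 2] touches the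
    real axis; the determinant is [1] for every [l], and [l^2 = 2] fixes the remaining dilation. *)
Lemma parabola_quartic (l s q : R) :
  q <> 0 -> s <> 0 -> l ^ 2 = 2 ->
  let g := mat_mul ((- l / q, - l / q), (3 * q / (2 * l), q / (2 * l)))
             ((s, 0), (q, / s)) in
  half_plane (hproj g) /\ horocycle_quartic 2 (hproj g) = 0.
Proof.
  intros Q S L; cbv zeta; rewrite mat_mul_eq.
  assert (L0 : l <> 0) by (intros ->; lra).
  assert (D : (- l / q * s + 3 * q / (2 * l) * 0)
              * (- l / q * q + q / (2 * l) * / s)
            - (- l / q * s + q / (2 * l) * 0)
              * (- l / q * q + 3 * q / (2 * l) * / s) = 1) by (field; auto).
  split; [now apply hproj_Im_pos | ].
  apply quartic_gram; [exact D | unfold gram_quadric].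
  transitivity ((l ^ 2 - 2) * 4 * q ^ 2 / (l ^ 2 * s ^ 2));
    [field; auto | rewrite L; field; auto].
Qed.

(** * Classification of the chains *)

(** [A = (r0 | rho0)^-1] followed by the shear [((1, c), (0, 1))]. *)
Lemma normalize_frame (c r1 r2 h1 h2 x y M : R) :
  r1 * h2 - r2 * h1 = 1 -> x ^ 2 + y ^ 2 = 1 -> M <> 0 ->
  x ^ 2 - y ^ 2 = c * M -> c <> 0 ->
  let rho1 := h1 + r1 / M in let rho2 := h2 + r2 / M in
  let u1 := x * r1 - y * rho1 in let u2 := x * r2 - y * rho2 in
  let v1 := y * r1 + x * rho1 in let v2 := y * r2 + x * rho2 in
  let A := ((v2 - c * u2, - u2), (c * u1 - v1, u1)) in
  SL2 A /\ mat_mul A ((r1, r2), (h1, h2)) = chain_mat c x y.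
Proof.
  intros H N HM HC Hc; cbv zeta; split.
  - unfold SL2, det2; cbn [fst snd].
    transitivity ((x ^ 2 + y ^ 2) * (r1 * h2 - r2 * h1));
      [field; auto | rewrite H, N; ring].
  - rewrite mat_mul_eq; unfold chain_mat; cbv zeta; rewrite HC.
    assert (H' : r1 * h2 = 1 + r2 * h1) by lra.
    replace (c / (c * M)) with (/ M) by (field; auto).
    apply mat_ext.
    + transitivity ((x + c * y) * (r1 * h2 - r2 * h1));
        [field; auto | rewrite H; ring].
    + transitivity ((c * x - y - / M * (x + c * y)) * (r1 * h2 - r2 * h1));
        [field; auto | rewrite H; ring].
    + transitivity (y * (r1 * h2 - r2 * h1)); [field; auto | rewrite H; ring].
    + transitivity ((x - / M * y) * (r1 * h2 - r2 * h1));
        [field; auto | rewrite H; ring].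
Qed.

Section Classification.
Variables (a b : Rbar) (r1 r2 h1 h2 p M Q s : R -> R).
Let inside (t : R) : Prop := Rbar_lt a t /\ Rbar_lt t b.
Hypothesis ab : Rbar_lt a b.
Hypothesis det1 : forall t, inside t -> r1 t * h2 t - r2 t * h1 t = 1.
Hypothesis s0 : forall t, inside t -> s t <> 0.
Hypothesis Dr1 : forall t, inside t ->
  is_derive r1 t (p t * (r1 t + M t * h1 t)).
Hypothesis Dr2 : forall t, inside t ->
  is_derive r2 t (p t * (r2 t + M t * h2 t)).
Hypothesis Dh1 : forall t, inside t ->
  is_derive h1 t (p t * (Q t * r1 t - h1 t)).
Hypothesis Dh2 : forall t, inside t ->
  is_derive h2 t (p t * (Q t * r2 t - h2 t)).
Hypothesis Ds : forall t, inside t ->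
  is_derive s t (3 / 2 * p t * (1 + M t * (Q t + M t)) * s t).
Hypothesis DM : forall t, inside t ->
  is_derive M t (p t * (M t * (1 + M t * (Q t + M t)))).
Hypothesis DQ : forall t, inside t ->
  is_derive Q t (p t * (- (1 + M t * (Q t + M t)) * Q t - 6 * M t
                        - 2 * M t * (M t * (Q t + M t)))).

Lemma constant_inside (f : R -> R) :
  (forall t, inside t -> is_derive f t 0) ->
  forall t1 t2, inside t1 -> inside t2 -> f t1 = f t2.
Proof.
  intros H t1 t2 [A1 B1] [A2 B2].
  apply (derive_zero_constant (V := R_NormedModule) a b); auto.
  intros t A B; exact (H t (conj A B)).
Qed.

Ltac der :=
  match goal with
  | Ht : inside ?t |- _ =>
      assert (Er1 := Dr1 t Ht); assert (Er2 := Dr2 t Ht);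
      assert (Eh1 := Dh1 t Ht); assert (Eh2 := Dh2 t Ht);
      assert (EM := DM t Ht); assert (EQ := DQ t Ht)
  end.

Lemma cubic_constant t1 t2 :
  inside t1 -> inside t2 -> M t1 ^ 3 / s t1 ^ 2 = M t2 ^ 3 / s t2 ^ 2.
Proof.
  apply (constant_inside (fun t => M t ^ 3 / s t ^ 2)).
  intros t Ht.
  assert (Es := Ds t Ht); assert (EM := DM t Ht); assert (Hs := s0 t Ht).
  auto_derive_with; field; auto.
Qed.

Lemma radius_constant t1 t2 :
  inside t1 -> inside t2 ->
  (1 + M t1 * (Q t1 + M t1)) ^ 2 / 4 + M t1 ^ 2
  = (1 + M t2 * (Q t2 + M t2)) ^ 2 / 4 + M t2 ^ 2.
Proof.
  apply (constant_inside
           (fun t => (1 + M t * (Q t + M t)) ^ 2 / 4 + M t ^ 2)).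
  intros t Ht; assert (EM := DM t Ht); assert (EQ := DQ t Ht).
  auto_derive_with; field.
Qed.

(** The sign of [M] is that of the constant [M^3 / s^2], the exponent being odd; no intermediate
    value argument is involved. *)
Lemma M_sign t1 t2 : inside t1 -> inside t2 -> 0 < M t1 -> 0 < M t2.
Proof.
  intros I1 I2 H.
  assert (E := cubic_constant t1 t2 I1 I2).
  assert (S1 := s0 t1 I1); assert (S2 := s0 t2 I2).
  assert (P : 0 < M t1 ^ 3 / s t1 ^ 2).
  { apply Rdiv_lt_0_compat; [now apply pow_lt | now apply pow2_gt_0]. }
  rewrite E in P.
  destruct (Rlt_or_le 0 (M t2)) as [L | L]; [exact L | exfalso].
  assert (P2 : 0 < s t2 ^ 2) by now apply pow2_gt_0.
  assert (0 < M t2 ^ 3).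
  { replace (M t2 ^ 3) with (M t2 ^ 3 / s t2 ^ 2 * s t2 ^ 2)
      by (field; auto).
    now apply Rmult_lt_0_compat. }
  assert (0 <= (- M t2) ^ 3) by (apply pow_le; lra).
  nra.
Qed.

Lemma M_zero t1 t2 : inside t1 -> inside t2 -> M t1 = 0 -> M t2 = 0.
Proof.
  intros I1 I2 H.
  assert (E := cubic_constant t1 t2 I1 I2).
  assert (S1 := s0 t1 I1); assert (S2 := s0 t2 I2).
  rewrite H in E.
  destruct (Req_dec (M t2) 0) as [Z | Z]; [exact Z | exfalso].
  apply (pow_nonzero (M t2) 3 Z).
  replace (M t2 ^ 3) with (M t2 ^ 3 / s t2 ^ 2 * s t2 ^ 2) by (field; auto).
  rewrite <- E; field; auto.
Qed.

(** With [C = cos (2 tau) = c M] and [S = sin (2 tau) = - c (1 + w) / 2], the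
    frame [(r | rho)], [rho = h + r / M], rotated back by the angle [tau] is
    constant. *)
Lemma generic_chain c :
  c <> 0 -> (forall t, inside t -> 0 < c * M t) ->
  (forall t, inside t ->
     c ^ 2 * ((1 + M t * (Q t + M t)) ^ 2 / 4 + M t ^ 2) = 1) ->
  exists A : mat2, SL2 A /\
    forall t, inside t -> exists x y : R,
      x ^ 2 + y ^ 2 = 1 /\ x ^ 2 - y ^ 2 <> 0 /\
      mat_mul A ((r1 t, r2 t), (h1 t, h2 t)) = chain_mat c x y.
Proof.
  intros Hc HM HN.
  set (S := fun t => - c * (1 + M t * (Q t + M t)) / 2).
  (* Half-angle formulas for [cos tau] and [sin tau]. As [cos (2 tau) = c M] is positive, the
     positive root works throughout and no angle function has to be chosen. *)
  set (x := fun t => sqrt ((1 + c * M t) / 2)).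
  set (y := fun t => S t / (2 * x t)).
  assert (HS : forall t, inside t -> (c * M t) ^ 2 + S t ^ 2 = 1).
  { intros t Ht; rewrite <- (HN t Ht); unfold S; field. }
  assert (Hx : forall t, inside t -> 0 < x t).
  { intros t Ht; apply sqrt_lt_R0; assert (H := HM t Ht); lra. }
  assert (Hx2 : forall t, inside t -> x t ^ 2 = (1 + c * M t) / 2).
  { intros t Ht; apply pow2_sqrt; assert (H := HM t Ht); lra. }
  assert (Hy2 : forall t, inside t -> y t ^ 2 = (1 - c * M t) / 2).
  { intros t Ht; unfold y.
    assert (X := Hx t Ht); assert (X2 := Hx2 t Ht); assert (E := HS t Ht).
    assert (P := HM t Ht).
    transitivity (S t ^ 2 / (4 * x t ^ 2)); [field; lra | rewrite X2].
    replace (S t ^ 2) with (1 - (c * M t) ^ 2) by lra.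
    field; lra. }
  assert (Hxy : forall t, inside t -> S t = 2 * x t * y t).
  { intros t Ht; unfold y; assert (X := Hx t Ht); field; lra. }
  assert (M0 : forall t, inside t -> M t <> 0).
  { intros t Ht Z; assert (P := HM t Ht); rewrite Z in P; lra. }
  assert (DS : forall t, inside t -> is_derive S t (2 * p t * M t * (c * M t))).
  { intros t Ht; der; unfold S; auto_derive_with; field. }
  assert (Dx : forall t, inside t -> is_derive x t (- p t * M t * y t)).
  { intros t Ht; der; assert (X := Hx t Ht); assert (P := HM t Ht).
    assert (E := Hxy t Ht); unfold S in E.
    unfold x at 1; auto_derive_with; [lra | ].
    fold (x t); replace ((1 + c * M t) * / 2) with ((1 + c * M t) / 2)
      by reflexivity.
    change (sqrt ((1 + c * M t) / 2)) with (x t).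
    apply (Rmult_eq_reg_r (4 * x t)); [ | lra].
    transitivity (p t * M t * (- 2) * (- c * (1 + M t * (Q t + M t)) / 2));
      [field; lra | rewrite E; ring]. }
  assert (Dy : forall t, inside t -> is_derive y t (p t * M t * x t)).
  { intros t Ht; assert (E1 := DS t Ht); assert (E2 := Dx t Ht).
    assert (X := Hx t Ht); unfold y at 1; auto_derive_with; [lra | ].
    assert (E := Hxy t Ht); assert (X2 := Hx2 t Ht); assert (Y2 := Hy2 t Ht).
    rewrite E; replace (c * M t) with (x t ^ 2 - y t ^ 2) by lra.
    field; lra. }
  clearbody x y; clear S HS DS Hxy.
  set (u1 := fun t => x t * r1 t - y t * (h1 t + r1 t / M t)).
  set (u2 := fun t => x t * r2 t - y t * (h2 t + r2 t / M t)).
  set (v1 := fun t => y t * r1 t + x t * (h1 t + r1 t / M t)).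
  set (v2 := fun t => y t * r2 t + x t * (h2 t + r2 t / M t)).
  assert (Du1 : forall t t', inside t -> inside t' -> u1 t = u1 t').
  { apply constant_inside; intros t Ht; der; assert (Ex := Dx t Ht).
    assert (Ey := Dy t Ht); assert (Z := M0 t Ht).
    unfold u1; auto_derive_with; field; auto. }
  assert (Du2 : forall t t', inside t -> inside t' -> u2 t = u2 t').
  { apply constant_inside; intros t Ht; der; assert (Ex := Dx t Ht).
    assert (Ey := Dy t Ht); assert (Z := M0 t Ht).
    unfold u2; auto_derive_with; field; auto. }
  assert (Dv1 : forall t t', inside t -> inside t' -> v1 t = v1 t').
  { apply constant_inside; intros t Ht; der; assert (Ex := Dx t Ht).
    assert (Ey := Dy t Ht); assert (Z := M0 t Ht).
    unfold v1; auto_derive_with; field; auto. }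
  assert (Dv2 : forall t t', inside t -> inside t' -> v2 t = v2 t').
  { apply constant_inside; intros t Ht; der; assert (Ex := Dx t Ht).
    assert (Ey := Dy t Ht); assert (Z := M0 t Ht).
    unfold v2; auto_derive_with; field; auto. }
  destruct (Rbar_interval_point a b ab) as (t0 & I0).
  fold (inside t0) in I0.
  assert (F : forall t, inside t ->
    SL2 ((v2 t - c * u2 t, - u2 t), (c * u1 t - v1 t, u1 t)) /\
    mat_mul ((v2 t - c * u2 t, - u2 t), (c * u1 t - v1 t, u1 t))
      ((r1 t, r2 t), (h1 t, h2 t)) = chain_mat c (x t) (y t)).
  { intros t Ht; apply normalize_frame; auto.
    - rewrite (Hx2 t Ht), (Hy2 t Ht); lra.
    - rewrite (Hx2 t Ht), (Hy2 t Ht); lra. }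
  exists ((v2 t0 - c * u2 t0, - u2 t0), (c * u1 t0 - v1 t0, u1 t0)).
  split; [now apply F | ].
  intros t Ht; exists (x t), (y t).
  rewrite (Hx2 t Ht), (Hy2 t Ht); split; [field | ].
  split; [assert (P := HM t Ht); lra | ].
  rewrite (Du1 t0 t), (Du2 t0 t), (Dv1 t0 t), (Dv2 t0 t) by auto.
  now apply F.
Qed.

(** For [M = 0] the system is [r' = p r], [h' = p (Q r - h)], [Q' = - p Q]. With [k = |r|], the
    quantities [u = r / k], [q = Q k] and [v = k h - q r] are constant, and [A] is the inverse of
    [(u | v)]. *)
Lemma degenerate_chain :
  (forall t, inside t -> M t = 0) ->
  exists (A : mat2) (q : R), SL2 A /\
    forall t, inside t -> exists k : R, k <> 0 /\
      mat_mul A ((r1 t, r2 t), (h1 t, h2 t)) = ((k, 0), (q, / k)).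
Proof.
  intros HM.
  set (k := fun t => sqrt (r1 t ^ 2 + r2 t ^ 2)).
  assert (N : forall t, inside t -> 0 < r1 t ^ 2 + r2 t ^ 2).
  { intros t Ht; apply (sum_squares_pos (- h1 t) (- h2 t)).
    rewrite <- (det1 t Ht); ring. }
  assert (Hk : forall t, inside t -> 0 < k t).
  { intros t Ht; apply sqrt_lt_R0; auto. }
  assert (Dk : forall t, inside t -> is_derive k t (p t * k t)).
  { intros t Ht; der; assert (P := N t Ht); assert (K := Hk t Ht).
    assert (Z := HM t Ht); rewrite Z in *.
    unfold k at 1; auto_derive_with.
    change (sqrt (r1 t * (r1 t * 1) + r2 t * (r2 t * 1))) with (k t).
    apply (Rmult_eq_reg_r (k t)); [ | lra].
    transitivity (p t * (r1 t ^ 2 + r2 t ^ 2)); [field; lra | ].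
    replace (r1 t ^ 2 + r2 t ^ 2) with (k t * k t); [ring | ].
    apply sqrt_def; lra. }
  clearbody k.
  set (u1 := fun t => r1 t / k t); set (u2 := fun t => r2 t / k t).
  set (q := fun t => Q t * k t).
  set (v1 := fun t => k t * h1 t - Q t * k t * r1 t).
  set (v2 := fun t => k t * h2 t - Q t * k t * r2 t).
  assert (Cu1 : forall t t', inside t -> inside t' -> u1 t = u1 t').
  { apply constant_inside; intros t Ht; der; assert (Ek := Dk t Ht).
    assert (K := Hk t Ht); rewrite (HM t Ht) in *.
    unfold u1; auto_derive_with; [lra | field; lra]. }
  assert (Cu2 : forall t t', inside t -> inside t' -> u2 t = u2 t').
  { apply constant_inside; intros t Ht; der; assert (Ek := Dk t Ht).
    assert (K := Hk t Ht); rewrite (HM t Ht) in *.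
    unfold u2; auto_derive_with; [lra | field; lra]. }
  assert (Cq : forall t t', inside t -> inside t' -> q t = q t').
  { apply constant_inside; intros t Ht; der; assert (Ek := Dk t Ht).
    rewrite (HM t Ht) in *; unfold q; auto_derive_with; ring. }
  assert (Cv1 : forall t t', inside t -> inside t' -> v1 t = v1 t').
  { apply constant_inside; intros t Ht; der; assert (Ek := Dk t Ht).
    rewrite (HM t Ht) in *; unfold v1; auto_derive_with; ring. }
  assert (Cv2 : forall t t', inside t -> inside t' -> v2 t = v2 t').
  { apply constant_inside; intros t Ht; der; assert (Ek := Dk t Ht).
    rewrite (HM t Ht) in *; unfold v2; auto_derive_with; ring. }
  destruct (Rbar_interval_point a b ab) as (t0 & I0).
  fold (inside t0) in I0.
  exists ((v2 t0, - u2 t0), (- v1 t0, u1 t0)), (q t0); split.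
  - unfold SL2, det2, u1, u2, v1, v2; cbn [fst snd].
    rewrite <- (det1 t0 I0); assert (K := Hk t0 I0); field; lra.
  - intros t Ht; exists (k t); assert (K := Hk t Ht); split; [lra | ].
    rewrite (Cu1 t0 t), (Cu2 t0 t), (Cv1 t0 t), (Cv2 t0 t), (Cq t0 t) by auto.
    assert (D := det1 t Ht).
    rewrite mat_mul_eq; unfold u1, u2, v1, v2, q; apply mat_ext.
    + transitivity (k t * (r1 t * h2 t - r2 t * h1 t));
        [field; lra | rewrite D; ring].
    + transitivity (Q t * k t * (r1 t * h2 t - r2 t * h1 t));
        [field; lra | rewrite D; ring].
    + field; lra.
    + transitivity (/ k t * (r1 t * h2 t - r2 t * h1 t));
        [field; lra | rewrite D; ring].
Qed.

Lemma frame_projection :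
  (exists A : mat2, SL2 A /\ forall t, inside t ->
     is_diagonal (mat_mul A ((r1 t, r2 t), (h1 t, h2 t)))) \/
  (exists (A : mat2) (c : R), SL2 A /\ c <> 0 /\ forall t, inside t ->
     let z := hproj (mat_mul A ((r1 t, r2 t), (h1 t, h2 t))) in
     half_plane z /\ horocycle_quartic c z = 0).
Proof.
  destruct (Rbar_interval_point a b ab) as (t0 & I0).
  destruct (Req_dec (M t0) 0) as [Z | Z].
  - assert (HM : forall t, inside t -> M t = 0).
    { intros t It; exact (M_zero t0 t I0 It Z). }
    destruct (degenerate_chain HM) as (A & q & HA & HE).
    destruct (Req_dec q 0) as [-> | Hq].
    + left; exists A; split; [exact HA | intros t Ht].
      destruct (HE t Ht) as (k & _ & ->).
      now split.
    + right.
      set (l := sqrt 2); assert (L : l ^ 2 = 2) by (apply pow2_sqrt; lra).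
      assert (L0 : l <> 0) by (intros L0; rewrite L0 in L; lra).
      exists (mat_mul ((- l / q, - l / q), (3 * q / (2 * l), q / (2 * l))) A), 2.
      split; [ | split; [lra | ]].
      * apply SL2_mul; [ | exact HA].
        unfold SL2, det2; cbn [fst snd]; field; auto.
      * intros t Ht; rewrite mat_mul_assoc.
        destruct (HE t Ht) as (k & K & ->).
        now apply parabola_quartic.
  - right.
    set (n := (1 + M t0 * (Q t0 + M t0)) ^ 2 / 4 + M t0 ^ 2).
    assert (Hn : 0 < n).
    { assert (0 < M t0 ^ 2) by now apply pow2_gt_0.
      assert (0 <= (1 + M t0 * (Q t0 + M t0)) ^ 2) by apply pow2_ge_0.
      unfold n; lra. }
    assert (Hn' : forall t, inside t ->
              (1 + M t * (Q t + M t)) ^ 2 / 4 + M t ^ 2 = n).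
    { intros t It; exact (radius_constant t t0 It I0). }
    (* The constant [n] determines the parameter up to sign by [c^2 n = 1]; the sign [e] is that of
       [M], so that [c M > 0] for [c = e / sqrt n]. *)
    set (e := if Rlt_dec 0 (M t0) then 1 else -1).
    assert (E2 : e ^ 2 = 1) by (unfold e; destruct Rlt_dec; ring).
    assert (HM : forall t, inside t -> 0 < e * M t).
    { intros t It; unfold e; destruct (Rlt_dec 0 (M t0)) as [L | L].
      - rewrite Rmult_1_l; exact (M_sign t0 t I0 It L).
      - destruct (Rlt_or_le 0 (M t)) as [L' | L'].
        + exfalso; apply L; exact (M_sign t t0 It I0 L').
        + destruct L' as [L' | L']; [lra | exfalso].
          apply Z; exact (M_zero t t0 It I0 L'). }
    assert (Hs : 0 < sqrt n) by now apply sqrt_lt_R0.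
    assert (Hs2 : sqrt n ^ 2 = n) by (apply pow2_sqrt; lra).
    assert (Hc : e / sqrt n <> 0).
    { apply Rmult_integral_contrapositive_currified.
      - intros E; rewrite E in E2; lra.
      - apply Rinv_neq_0_compat; lra. }
    destruct (generic_chain (e / sqrt n) Hc) as (A & HA & HE).
    + intros t It; replace (e / sqrt n * M t) with (e * M t / sqrt n)
        by (field; lra).
      apply Rdiv_lt_0_compat; [now apply HM | exact Hs].
    + intros t It; rewrite (Hn' t It).
      transitivity (e ^ 2 * n / sqrt n ^ 2); [field; lra | ].
      rewrite E2, Hs2; field; lra.
    + exists A, (e / sqrt n); split; [exact HA | split; [exact Hc | ]].
      intros t Ht.
      destruct (HE t Ht) as (x & y & N & C & ->).
      now apply chain_mat_quartic.
Qed.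

End Classification.

Lemma horocycle_chain_projection (a b : Rbar) (g : R -> mat2) :
  Rbar_lt a b -> horocycle_chain a b g ->
  (exists A : mat2, SL2 A /\
     forall t : R, Rbar_lt a t -> Rbar_lt t b ->
       is_diagonal (mat_mul A (g t))) \/
  (exists (A : mat2) (c : R), SL2 A /\ c <> 0 /\
     forall t : R, Rbar_lt a t -> Rbar_lt t b ->
       half_plane (hproj (mat_mul A (g t))) /\
       horocycle_quartic c (hproj (mat_mul A (g t))) = 0).
Proof.
  intros ab HC.
  destruct (chain_equations a b g HC)
    as (r1 & r2 & h1 & h2 & p & M & Q & s & H).
  destruct (frame_projection a b r1 r2 h1 h2 p M Q s ab) as [K | K];
    try (intros t []; now apply H).
  - left; destruct K as (A & HA & K); exists A; split; [exact HA | ].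
    intros t Ta Tb; rewrite (proj1 (H t Ta Tb)); now apply K.
  - right; destruct K as (A & c & HA & Hc & K); exists A, c.
    split; [exact HA | split; [exact Hc | ]].
    intros t Ta Tb; rewrite (proj1 (H t Ta Tb)); now apply K.
Qed.

(** * The explicit chain *)

Definition explicit_chain (c t : R) : mat2 := chain_mat c (cos t) (sin t).

Lemma cos2_sin2 t : cos t ^ 2 + sin t ^ 2 = 1.
Proof. rewrite <- (sin2_cos2 t); unfold Rsqr; ring. Qed.

Lemma cos_double t : cos t ^ 2 - sin t ^ 2 = cos (2 * t).
Proof. rewrite cos_2a; ring. Qed.

Lemma cos_double_pos t : in_range t -> 0 < cos (2 * t).
Proof. intros [H1 H2]; apply cos_gt_0; lra. Qed.

(** The chain equation is [r' = p r + h], [h' = q r - p h] for the following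
    [p] and [q]. *)
Definition chain_p (c t : R) : R := c * sec (2 * t).
Definition chain_q (c t : R) : R :=
  - (1 + c * (c + 2 * sin (2 * t)) * sec (2 * t) ^ 2).

Lemma explicit_chain_eq c t :
  explicit_chain c t
  = ((cos t + c * sin t, sin t),
     (c * cos t - sin t - chain_p c t * (cos t + c * sin t),
      cos t - chain_p c t * sin t)).
Proof.
  unfold explicit_chain, chain_mat; cbv zeta; rewrite cos_double.
  reflexivity.
Qed.

Lemma explicit_chain_det c t : SL2 (explicit_chain c t).
Proof. apply chain_mat_det, cos2_sin2. Qed.

Lemma is_derive_chain_p c t :
  in_range t ->
  is_derive (chain_p c) t (2 * sin (2 * t) * sec (2 * t) * chain_p c t).
Proof.
  intros H; apply cos_double_pos in H; unfold chain_p, sec.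
  auto_derive; [lra | field; lra].
Qed.

Lemma is_derive_explicit_chain c t :
  in_range t ->
  is_derive (fun t => fst (fst (explicit_chain c t))) t
    (chain_p c t * fst (fst (explicit_chain c t))
     + fst (snd (explicit_chain c t))) /\
  is_derive (fun t => snd (fst (explicit_chain c t))) t
    (chain_p c t * snd (fst (explicit_chain c t))
     + snd (snd (explicit_chain c t))) /\
  is_derive (fun t => fst (snd (explicit_chain c t))) t
    (chain_q c t * fst (fst (explicit_chain c t))
     - chain_p c t * fst (snd (explicit_chain c t))) /\
  is_derive (fun t => snd (snd (explicit_chain c t))) t
    (chain_q c t * snd (fst (explicit_chain c t))
     - chain_p c t * snd (snd (explicit_chain c t))).
Proof.
  intros H; assert (Dp := is_derive_chain_p c t H).
  (* That is, [q = - 1 - p^2 - p']. Since [r'' = (p' + p^2 + q) r], this says [r'' = - r]: the first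
     column is a Hooke orbit. *)
  assert (E : chain_q c t = - 1 - chain_p c t ^ 2
                - 2 * sin (2 * t) * sec (2 * t) * chain_p c t).
  { unfold chain_q, chain_p; ring. }
  rewrite E; clear E; rewrite explicit_chain_eq; cbn [fst snd].
  set (p := chain_p c) in *.
  split; [ | split; [ | split]].
  - apply (is_derive_ext (fun t => cos t + c * sin t)).
    + intros s; now rewrite explicit_chain_eq.
    + auto_derive; auto; ring.
  - apply (is_derive_ext (fun t => sin t)).
    + intros s; now rewrite explicit_chain_eq.
    + auto_derive; auto; ring.
  - apply (is_derive_ext (fun t => c * cos t - sin t
                                   - p t * (cos t + c * sin t))).
    + intros s; now rewrite explicit_chain_eq.
    + clearbody p; auto_derive_with; ring.
  - apply (is_derive_ext (fun t => cos t - p t * sin t)).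
    + intros s; now rewrite explicit_chain_eq.
    + clearbody p; auto_derive_with; ring.
Qed.

Lemma R2_ext (x y x' y' : R) : x = x' -> y = y' -> (x, y) = (x', y') :> R2.
Proof. now intros -> ->. Qed.

Lemma explicit_chain_solution c : chain_solution c (explicit_chain c).
Proof.
  split.
  - rewrite explicit_chain_eq; unfold mat_id, chain_p, sec.
    rewrite Rmult_0_r, cos_0, sin_0; apply mat_ext; field.
  - intros t H; destruct (is_derive_explicit_chain c t H)
      as (D1 & D2 & D3 & D4).
    assert (E := explicit_chain_eq c t).
    destruct (explicit_chain c t) as [[r1 r2] [h1 h2]] eqn:G.
    cbn [fst snd] in *; split.
    + apply (is_derive_ext (fun t => (fst (fst (explicit_chain c t)),
        snd (fst (explicit_chain c t))))).
      { intros s; symmetry; apply surjective_pairing. }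
      exact (is_derive_pair _ _ _ _ _ D1 D2).
    + apply (is_derive_ext (fun t => (fst (snd (explicit_chain c t)),
        snd (snd (explicit_chain c t))))).
      { intros s; symmetry; apply surjective_pairing. }
      refine (is_derive_eq _ _ _ _ (is_derive_pair _ _ _ _ _ D3 D4) _).
      apply R2_ext.
      * change (chain_q c t * r1 - chain_p c t * h1
          = chain_q c t * r1 + - chain_p c t * h1); ring.
      * change (chain_q c t * r2 - chain_p c t * h2
          = chain_q c t * r2 + - chain_p c t * h2); ring.
Qed.

(** The coefficient matrix has trace zero, so the Wronskian of two solutions is constant. The two
    Wronskians of [(r, h)] with a fundamental system of determinant [1] recover [(r, h)] by Cramer's
    rule. Each row of the matrix [g] is such a solution. *)
Lemma linear_system_unique (p q r h X1 H1 X2 H2 : R -> R) :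
  (forall t, in_range t ->
     is_derive r t (p t * r t + h t) /\ is_derive h t (q t * r t - p t * h t) /\
     is_derive X1 t (p t * X1 t + H1 t) /\
     is_derive H1 t (q t * X1 t - p t * H1 t) /\
     is_derive X2 t (p t * X2 t + H2 t) /\
     is_derive H2 t (q t * X2 t - p t * H2 t) /\
     X1 t * H2 t - X2 t * H1 t = 1) ->
  X1 0 = 1 -> H1 0 = 0 -> X2 0 = 0 -> H2 0 = 1 ->
  forall t, in_range t ->
    r t = r 0 * X1 t + h 0 * X2 t /\ h t = r 0 * H1 t + h 0 * H2 t.
Proof.
  intros H A1 A2 A3 A4.
  assert (I0 : in_range 0) by (unfold in_range; assert (P := PI_RGT_0); lra).
  assert (W1 : forall t, in_range t -> r t * H1 t - h t * X1 t = - h 0).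
  { intros t It.
    transitivity (r 0 * H1 0 - h 0 * X1 0); [ | rewrite A1, A2; ring].
    apply (derive_zero_constant (V := R_NormedModule) (Finite (- (PI / 4)))
      (Finite (PI / 4)) (fun t => r t * H1 t - h t * X1 t)); try apply It;
      try apply I0.
    intros s S1 S2; destruct (H s (conj S1 S2)) as (B1 & B2 & B3 & B4 & _).
    apply is_derive_eqR with (l := 0); [ | reflexivity].
    auto_derive_with; ring. }
  assert (W2 : forall t, in_range t -> r t * H2 t - h t * X2 t = r 0).
  { intros t It.
    transitivity (r 0 * H2 0 - h 0 * X2 0); [ | rewrite A3, A4; ring].
    apply (derive_zero_constant (V := R_NormedModule) (Finite (- (PI / 4)))
      (Finite (PI / 4)) (fun t => r t * H2 t - h t * X2 t)); try apply It;
      try apply I0.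
    intros s S1 S2; destruct (H s (conj S1 S2)) as (B1 & B2 & _ & _ & B5 & B6 & _).
    apply is_derive_eqR with (l := 0); [ | reflexivity].
    auto_derive_with; ring. }
  intros t It; assert (E1 := W1 t It); assert (E2 := W2 t It).
  destruct (H t It) as (_ & _ & _ & _ & _ & _ & D).
  split.
  - transitivity (r t * (X1 t * H2 t - X2 t * H1 t)); [rewrite D; ring | ].
    rewrite <- E2; replace (h 0) with (- (r t * H1 t - h t * X1 t)) by lra.
    ring.
  - transitivity (h t * (X1 t * H2 t - X2 t * H1 t)); [rewrite D; ring | ].
    rewrite <- E2; replace (h 0) with (- (r t * H1 t - h t * X1 t)) by lra.
    ring.
Qed.

Lemma chain_solution_unique c g t :
  chain_solution c g -> in_range t -> g t = explicit_chain c t.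
Proof.
  intros [G0 HG] It.
  destruct (explicit_chain_solution c) as [E0 _].
  set (r1 := fun t => fst (fst (g t)) : R).
  set (r2 := fun t => snd (fst (g t)) : R).
  set (h1 := fun t => fst (snd (g t)) : R).
  set (h2 := fun t => snd (snd (g t)) : R).
  set (X1 := fun t => fst (fst (explicit_chain c t)) : R).
  set (X2 := fun t => snd (fst (explicit_chain c t)) : R).
  set (H1 := fun t => fst (snd (explicit_chain c t)) : R).
  set (H2 := fun t => snd (snd (explicit_chain c t)) : R).
  assert (D : forall t, in_range t ->
    is_derive r1 t (chain_p c t * r1 t + h1 t) /\
    is_derive r2 t (chain_p c t * r2 t + h2 t) /\
    is_derive h1 t (chain_q c t * r1 t - chain_p c t * h1 t) /\
    is_derive h2 t (chain_q c t * r2 t - chain_p c t * h2 t)).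
  { intros s Is; destruct (HG s Is) as [Dr Dh].
    assert (D1 := is_derive_fst _ _ _ Dr); assert (D2 := is_derive_snd _ _ _ Dr).
    assert (D3 := is_derive_fst _ _ _ Dh); assert (D4 := is_derive_snd _ _ _ Dh).
    split; [exact D1 | split; [exact D2 | split]].
    - refine (is_derive_eqR _ _ _ _ D3 _).
      change (chain_q c s * r1 s + - chain_p c s * h1 s
        = chain_q c s * r1 s - chain_p c s * h1 s); ring.
    - refine (is_derive_eqR _ _ _ _ D4 _).
      change (chain_q c s * r2 s + - chain_p c s * h2 s
        = chain_q c s * r2 s - chain_p c s * h2 s); ring. }
  assert (DX := is_derive_explicit_chain c).
  assert (DD : forall s, X1 s * H2 s - X2 s * H1 s = 1)
    by (intros s; exact (explicit_chain_det c s)).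
  assert (I1 : X1 0 = 1) by (unfold X1; now rewrite E0).
  assert (I2 : H1 0 = 0) by (unfold H1; now rewrite E0).
  assert (I3 : X2 0 = 0) by (unfold X2; now rewrite E0).
  assert (I4 : H2 0 = 1) by (unfold H2; now rewrite E0).
  destruct (linear_system_unique (chain_p c) (chain_q c) r1 h1 X1 H1 X2 H2)
    with (t := t) as [F1 F2]; auto.
  { intros s Is; destruct (D s Is) as (B1 & B2 & B3 & B4).
    destruct (DX s Is) as (C1 & C2 & C3 & C4); repeat (split; [assumption | ]).
    apply DD. }
  destruct (linear_system_unique (chain_p c) (chain_q c) r2 h2 X1 H1 X2 H2)
    with (t := t) as [F3 F4]; auto.
  { intros s Is; destruct (D s Is) as (B1 & B2 & B3 & B4).
    destruct (DX s Is) as (C1 & C2 & C3 & C4); repeat (split; [assumption | ]).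
    apply DD. }
  assert (J1 : r1 0 = 1) by (unfold r1; now rewrite G0).
  assert (J2 : h1 0 = 0) by (unfold h1; now rewrite G0).
  assert (J3 : r2 0 = 0) by (unfold r2; now rewrite G0).
  assert (J4 : h2 0 = 1) by (unfold h2; now rewrite G0).
  transitivity (((r1 t, r2 t), (h1 t, h2 t)) : mat2).
  { unfold r1, r2, h1, h2; now rewrite <- !surjective_pairing. }
  transitivity (((X1 t, X2 t), (H1 t, H2 t)) : mat2).
  { rewrite F1, F2, F3, F4, J1, J2, J3, J4; apply mat_ext; ring. }
  unfold X1, X2, H1, H2; now rewrite <- !surjective_pairing.
Qed.

(** * The explicit chain as the projection of a null geodesic *)

Definition chart_inv (k : mat2) : R3 :=
  (fst k, (fst (fst k) * fst (snd k) + snd (fst k) * snd (snd k))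
          / (fst (fst k) ^ 2 + snd (fst k) ^ 2)).

(** In [chart] the vector [h - t r] is orthogonal to [r], so [t] is the coefficient of the
    orthogonal projection of [h] onto [r]. *)
Lemma chart_inv_correct (k : mat2) :
  SL2 k -> chart_dom (chart_inv k) /\ chart (chart_inv k) = k.
Proof.
  destruct k as [[a c] [b d]]; unfold SL2, det2; cbn [fst snd]; intros H.
  assert (N : 0 < a ^ 2 + c ^ 2).
  { apply (sum_squares_pos (- b) (- d)); rewrite <- H; ring. }
  split; [exact N | unfold chart, chart_inv; cbn [fst snd]].
  assert (H' : a * d = 1 + c * b) by lra.
  apply mat_ext; auto.
  - transitivity (b * (a ^ 2 + c ^ 2) / (a ^ 2 + c ^ 2)); [ | field; lra].
    transitivity ((a * a * b + c * (a * d) - c) / (a ^ 2 + c ^ 2));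
      [field; lra | rewrite H'; field; lra].
  - transitivity (d * (a ^ 2 + c ^ 2) / (a ^ 2 + c ^ 2)); [ | field; lra].
    transitivity ((a * (1 + c * b) + c * c * d) / (a ^ 2 + c ^ 2));
      [field; lra | rewrite <- H'; field; lra].
Qed.

Lemma is_derive_chart_inv (r1 r2 h1 h2 : R -> R) (t p q m : R) :
  is_derive r1 t (p * r1 t + m * h1 t) -> is_derive r2 t (p * r2 t + m * h2 t) ->
  is_derive h1 t (q * r1 t - p * h1 t) -> is_derive h2 t (q * r2 t - p * h2 t) ->
  r1 t * h2 t - r2 t * h1 t = 1 ->
  let u := fun t => chart_inv ((r1 t, r2 t), (h1 t, h2 t)) in
  is_derive u t (mc_vec (u t) p q m).
Proof.
  intros D1 D2 D3 D4 H; cbv zeta.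
  assert (N : 0 < r1 t ^ 2 + r2 t ^ 2).
  { apply (sum_squares_pos (- h1 t) (- h2 t)); rewrite <- H; ring. }
  assert (N' : r1 t * (r1 t * 1) + r2 t * (r2 t * 1) <> 0)
    by (simpl in N; lra).
  unfold mc_vec.
  rewrite (proj2 (chart_inv_correct ((r1 t, r2 t), (h1 t, h2 t)) H)).
  apply (is_derive_pair (V := R2) (W := R_NormedModule)).
  - exact (is_derive_pair _ _ _ _ _ D1 D2).
  - unfold chart_inv, radius2; cbn [fst snd].
    set (n := r1 t ^ 2 + r2 t ^ 2) in *.
    (* Lagrange's identity for [r] and [h], whose determinant is [1]. *)
    assert (L : (r1 t * h1 t + r2 t * h2 t) ^ 2 + 1
                = n * (h1 t ^ 2 + h2 t ^ 2)).
    { replace 1 with ((r1 t * h2 t - r2 t * h1 t) ^ 2) by (rewrite H; ring).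
      unfold n; ring. }
    auto_derive_with.
    replace (r1 t * (r1 t * 1) + r2 t * (r2 t * 1)) with n by (unfold n; ring).
    transitivity (q + m * (n * (h1 t ^ 2 + h2 t ^ 2)) / n ^ 2
      - 2 * ((r1 t * h1 t + r2 t * h2 t) / n) * p
      - 2 * m * ((r1 t * h1 t + r2 t * h2 t) / n) ^ 2).
    + apply (Rmult_eq_reg_r (n ^ 2)); [ | apply pow_nonzero; lra].
      transitivity (q * n * (r1 t ^ 2 + r2 t ^ 2)
        + m * (h1 t ^ 2 + h2 t ^ 2) * n
        - 2 * (r1 t * h1 t + r2 t * h2 t) * (p * (r1 t ^ 2 + r2 t ^ 2)
        + m * (r1 t * h1 t + r2 t * h2 t))); [field; lra | ].
      fold n; field; lra.
    + rewrite <- L; field; lra.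
Qed.

Section ExplicitChain.
Variable c : R.
Hypothesis c0 : c <> 0.

Let p := chain_p c.
Let q := chain_q c.
Let u (t : R) : R3 := chart_inv (explicit_chain c t).
Let u1 (t : R) : R3 := mc_vec (u t) (p t) (q t) 1.
Let p1 (t : R) : R := 2 * sin (2 * t) * sec (2 * t) * p t.
Let q1 (t : R) : R := 4 * sin (2 * t) * sec (2 * t) * (q t + 1) - 4 * p t.
Let T (t : R) : R := snd (u t).
Let n (t : R) : R := radius2 (u t).
Let T1 (t : R) : R := snd (u1 t).
(** The second derivative of [u]: the first two entries are [r'' = - r], the last one differentiates
    [T' = q - 2 T p - T^2 + 1 / n^2] with [n' = 2 (p + T) n]. *)
Let u2 (t : R) : R3 :=
  ((- fst (fst (u t)), - snd (fst (u t))),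
   q1 t - 2 * (T1 t * p t + T t * p1 t) - 2 * T t * T1 t
   - 2 * (2 * (p t + T t) * n t) / n t ^ 3).
(** The lift is dictated by the constancy of [M^3 / s^2]: here [m = 1] and
    [M = 1 / p = cos (2 t) / c], so [s] is [cos (2 t)] to the power [3/2] up to a constant
    factor. *)
Let s (t : R) : R := cos (2 * t) * sqrt (cos (2 * t)).
Let s1 (t : R) : R := - 3 * sin (2 * t) * sec (2 * t) * s t.
Let s2 (t : R) : R :=
  (- 6 * sec (2 * t) ^ 2 + 9 * (sin (2 * t) * sec (2 * t)) ^ 2) * s t.

Lemma explicit_dom t : chart_dom (u t).
Proof. apply chart_inv_correct, explicit_chain_det. Qed.

Lemma explicit_chart t : chart (u t) = explicit_chain c t.
Proof. apply chart_inv_correct, explicit_chain_det. Qed.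

Lemma explicit_is_derive_u t : in_range t -> is_derive u t (u1 t).
Proof.
  intros H; destruct (is_derive_explicit_chain c t H) as (D1 & D2 & D3 & D4).
  assert (E := explicit_chain_det c t).
  rewrite <- (Rmult_1_l (fst (snd (explicit_chain c t)))) in D1.
  rewrite <- (Rmult_1_l (snd (snd (explicit_chain c t)))) in D2.
  assert (D := is_derive_chart_inv _ _ _ _ t (p t) (q t) 1 D1 D2 D3 D4 E).
  cbv beta zeta in D; rewrite <- !surjective_pairing in D.
  refine (is_derive_ext _ _ _ _ _ D).
  intros r; now rewrite <- !surjective_pairing.
Qed.

Lemma explicit_is_derive_p t : in_range t -> is_derive p t (p1 t).
Proof. apply is_derive_chain_p. Qed.

Lemma explicit_is_derive_q t : in_range t -> is_derive q t (q1 t).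
Proof.
  intros H; apply cos_double_pos in H.
  unfold q1, q, p, chain_q, chain_p, sec.
  auto_derive; [lra | field; lra].
Qed.

Lemma explicit_is_derive_T t : in_range t -> is_derive T t (T1 t).
Proof.
  intros H; exact (proj2 (proj2 (is_derive_R3 _ _ _ (explicit_is_derive_u t H)))).
Qed.

Lemma explicit_is_derive_n t :
  in_range t -> is_derive n t (2 * (p t + T t) * n t).
Proof.
  intros H; destruct (is_derive_R3 _ _ _ (explicit_is_derive_u t H))
    as (D1 & D2 & _).
  assert (N := explicit_dom t).
  set (x := (fun t => fst (fst (u t))) : R -> R) in *.
  set (y := (fun t => snd (fst (u t))) : R -> R) in *.
  change (0 < x t ^ 2 + y t ^ 2) in N.
  change (is_derive x t (p t * x t
    + 1 * (T t * x t - y t / (x t ^ 2 + y t ^ 2)))) in D1.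
  change (is_derive y t (p t * y t
    + 1 * (T t * y t + x t / (x t ^ 2 + y t ^ 2)))) in D2.
  change (is_derive (fun t => x t ^ 2 + y t ^ 2) t
    (2 * (p t + T t) * (x t ^ 2 + y t ^ 2))).
  clearbody x y p T; auto_derive_with; field; lra.
Qed.

Lemma explicit_is_derive_u1 t : in_range t -> is_derive u1 t (u2 t).
Proof.
  intros H.
  assert (Dp := explicit_is_derive_p t H).
  assert (Dq := explicit_is_derive_q t H).
  assert (DT := explicit_is_derive_T t H).
  assert (Dn := explicit_is_derive_n t H).
  destruct (is_derive_explicit_chain c t H) as (D1 & D2 & D3 & D4).
  fold p in D1, D2, D3, D4; fold q in D3, D4.
  assert (N := explicit_dom t); change (0 < n t) in N.
  assert (E : q t = - 1 - p t ^ 2 - p1 t).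
  { unfold q, p1, p, chain_q, chain_p; ring. }
  unfold u1, mc_vec, u2.
  apply (is_derive_pair (V := R2) (W := R_NormedModule)).
  - apply (is_derive_ext (fun t =>
      (p t * fst (fst (explicit_chain c t)) + fst (snd (explicit_chain c t)),
       p t * snd (fst (explicit_chain c t)) + snd (snd (explicit_chain c t))))).
    { intros r; rewrite explicit_chart; apply R2_ext;
        unfold u, chart_inv; cbn [fst snd]; ring. }
    set (a := (fun t => fst (fst (explicit_chain c t))) : R -> R).
    set (b := (fun t => fst (snd (explicit_chain c t))) : R -> R).
    set (d := (fun t => snd (fst (explicit_chain c t))) : R -> R).
    set (e := (fun t => snd (snd (explicit_chain c t))) : R -> R).
    change (is_derive a t (p t * a t + b t)) in D1.
    change (is_derive d t (p t * d t + e t)) in D2.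
    change (is_derive b t (q t * a t - p t * b t)) in D3.
    change (is_derive e t (q t * d t - p t * e t)) in D4.
    change (is_derive (fun t => (p t * a t + b t, p t * d t + e t) : R2) t
      (- a t, - d t)).
    clearbody a b d e p q p1.
    apply (is_derive_pair (V := R_NormedModule) (W := R_NormedModule));
      auto_derive_with; rewrite E; ring.
  - change (is_derive (fun t => q t - 2 * T t * p t - T t ^ 2 * 1
      + 1 / n t ^ 2) t (q1 t - 2 * (T1 t * p t + T t * p1 t) - 2 * T t * T1 t
       - 2 * (2 * (p t + T t) * n t) / n t ^ 3)).
    clearbody p q T n p1 q1 T1; auto_derive_with; [ | field; lra].
    apply Rmult_integral_contrapositive_currified; lra.
Qed.

Lemma explicit_is_derive_s t :
  in_range t -> is_derive s t (s1 t) /\ is_derive s1 t (s2 t).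
Proof.
  intros H; apply cos_double_pos in H.
  assert (D : is_derive s t (s1 t)).
  { unfold s, s1, s, sec; auto_derive; [lra | ].
    assert (Q := sqrt_lt_R0 _ H).
    apply (Rmult_eq_reg_r (sqrt (cos (2 * t)))); [ | lra].
    transitivity (- 2 * sin (2 * t) * (sqrt (cos (2 * t))
      * sqrt (cos (2 * t))) - cos (2 * t) * sin (2 * t)); [field; lra | ].
    transitivity (- 3 * sin (2 * t) * (sqrt (cos (2 * t))
      * sqrt (cos (2 * t)))); [ | field; lra].
    rewrite sqrt_def by lra; ring. }
  split; [exact D | ].
  set (k := fun t => - 3 * sin (2 * t) * sec (2 * t)).
  assert (Dk : is_derive k t (- 6 * sec (2 * t) ^ 2)).
  { unfold k, sec; auto_derive; [lra | ].
    transitivity (- 6 * (cos (2 * t) ^ 2 + sin (2 * t) ^ 2)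
                  * (/ cos (2 * t)) ^ 2); [field; lra | ].
    rewrite cos2_sin2; ring. }
  change (is_derive (fun t => k t * s t) t (s2 t)).
  assert (E : s2 t = - 6 * sec (2 * t) ^ 2 * s t + k t * (k t * s t))
    by (unfold s2, k; ring).
  rewrite E; change (s1 t) with (k t * s t) in D.
  clearbody k s; auto_derive_with; ring.
Qed.

Lemma continuous_u2 t : in_range t -> continuous u2 t.
Proof.
  intros H.
  assert (Dp := explicit_is_derive_p t H).
  assert (Dq := explicit_is_derive_q t H).
  assert (DT := explicit_is_derive_T t H).
  assert (Dn := explicit_is_derive_n t H).
  assert (DT1 := proj2 (proj2 (is_derive_R3 _ _ _ (explicit_is_derive_u1 t H)))).
  destruct (is_derive_R3 _ _ _ (explicit_is_derive_u t H)) as (D1 & D2 & _).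
  assert (P := cos_double_pos t H).
  assert (N := explicit_dom t); change (0 < n t) in N.
  set (k := fun t => sin (2 * t) * sec (2 * t)).
  assert (Dk : ex_derive k t) by (unfold k, sec; auto_derive; lra).
  unfold u2.
  apply (continuous_pair (V := R2) (W := R_NormedModule));
    [apply (continuous_pair (V := R_NormedModule) (W := R_NormedModule)) | ];
    apply (ex_derive_continuous (V := R_NormedModule)).
  - exact (ex_intro _ _ (is_derive_opp (V := R_NormedModule)
      (fun s => fst (fst (u s))) _ _ D1)).
  - exact (ex_intro _ _ (is_derive_opp (V := R_NormedModule)
      (fun s => snd (fst (u s))) _ _ D2)).
  - change (is_derive T1 t (snd (u2 t))) in DT1.
    apply (ex_derive_ext (fun t => 4 * k t * (q t + 1) - 4 * p t
      - 2 * (T1 t * p t + T t * (2 * k t * p t)) - 2 * T t * T1 t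
      - 2 * (2 * (p t + T t) * n t) / n t ^ 3)).
    { intros r; match goal with |- ?a = ?b => change (@eq R a b) end.
      unfold q1, p1, k, Rdiv; ring. }
    generalize dependent (snd (u2 t)); intros l DT1.
    clearbody k p q T T1 n.
    auto_derive; repeat split; auto; try (eexists; eassumption).
    repeat apply Rmult_integral_contrapositive_currified; lra.
Qed.

Lemma continuous_s2 t : in_range t -> continuous s2 t.
Proof.
  intros H; assert (P := cos_double_pos t H).
  apply (ex_derive_continuous (V := R_NormedModule)).
  unfold s2, s, sec; auto_derive; repeat split; auto; lra.
Qed.

(** The components of the velocity are the functions [p], [q], [1], so uniqueness of derivatives
    gives these values without expanding [d_p], [d_q], [d_m]. *)
Lemma explicit_mc_derivatives t :
  in_range t ->
  d_p (u t) (u1 t) (u1 t) + mc_p (u t) (u2 t) = p1 t /\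
  d_q (u t) (u1 t) (u1 t) + mc_q (u t) (u2 t) = q1 t /\
  d_m (u t) (u1 t) (u1 t) + mc_m (u t) (u2 t) = 0.
Proof.
  intros H.
  destruct (is_derive_mc u u1 t _ _ (explicit_dom t) (explicit_is_derive_u t H)
    (explicit_is_derive_u1 t H)) as (Dm & Dp & Dq).
  assert (E := fun r => mc_of_vec (u r) (p r) (q r) 1 (explicit_dom r)).
  split; [ | split].
  - apply (is_derive_unique_val _ _ _ _ Dp).
    apply (is_derive_ext p); [ | now apply explicit_is_derive_p].
    intros r; symmetry; apply E.
  - apply (is_derive_unique_val _ _ _ _ Dq).
    apply (is_derive_ext q); [ | now apply explicit_is_derive_q].
    intros r; symmetry; apply E.
  - apply (is_derive_unique_val _ _ _ _ Dm).
    apply (is_derive_ext (fun _ => 1)); [ | apply @is_derive_const].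
    intros r; symmetry; apply E.
Qed.

Lemma explicit_s_neq0 t : in_range t -> s t <> 0.
Proof.
  intros H; apply cos_double_pos in H; unfold s.
  assert (Q := sqrt_lt_R0 _ H).
  apply Rmult_integral_contrapositive_currified; lra.
Qed.

Lemma explicit_null_geodesic :
  null_geodesic (Finite (- (PI / 4))) (Finite (PI / 4)) horocycle_metric
    (fun t => (u t, s t) : R4).
Proof.
  exists (fun t => (u1 t, s1 t)), (fun t => (u2 t, s2 t)).
  intros t Ha Hb; assert (H : in_range t) by (split; assumption).
  assert (P := cos_double_pos t H).
  destruct (explicit_is_derive_s t H) as [S1 S2].
  destruct (mc_of_vec (u t) (p t) (q t) 1 (explicit_dom t)) as (Ep & Eq & Em).
  fold (u1 t) in Ep, Eq, Em.
  destruct (explicit_mc_derivatives t H) as (Fp & Fq & Fm).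
  assert (S0 := explicit_s_neq0 t H).
  assert (HB : Bset chart_dom (u t, s t))
    by (split; [apply explicit_dom | exact S0]).
  set (k := sin (2 * t) * sec (2 * t)).
  assert (Es1 : s1 t / s t = - 3 * k) by (unfold s1, k; field; auto).
  assert (Es2 : s2 t / s t = - 6 * (1 + k ^ 2) + 9 * k ^ 2).
  { unfold s2; replace (sec (2 * t) ^ 2) with (1 + k ^ 2);
      [unfold k; field; auto | ].
    unfold k, sec.
    transitivity ((cos (2 * t) ^ 2 + sin (2 * t) ^ 2) * (/ cos (2 * t)) ^ 2);
      [field; lra | rewrite cos2_sin2; ring]. }
  assert (Eq' : q t = - 1 - p t ^ 2 - 2 * k * p t).
  { unfold q, p, k, chain_q, chain_p; ring. }
  assert (Ep1 : p1 t = 2 * k * p t) by (unfold p1, k; ring).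
  assert (Eq1 : q1 t = 4 * k * (q t + 1) - 4 * p t) by (unfold q1, k; ring).
  split; [ | split; [ | split; [ | split; [ | split]]]].
  - apply (is_derive_pair (V := R3) (W := R_NormedModule)); auto.
    now apply explicit_is_derive_u.
  - apply (is_derive_pair (V := R3) (W := R_NormedModule)); auto.
    now apply explicit_is_derive_u1.
  - apply (continuous_pair (V := R3) (W := R_NormedModule)).
    + now apply continuous_u2.
    + now apply continuous_s2.
  - intros Z; assert (Z1 : u1 t = zero) by exact (f_equal fst Z).
    rewrite Z1 in Em; destruct (mc_zero (u t)) as (Z2 & _); lra.
  - unfold horocycle_metric, mc_eta; cbn [fst snd]; rewrite Ep, Eq, Em.
    replace (p t * s1 t / s t) with (p t * (s1 t / s t)) by (field; auto).
    rewrite Es1, Eq'; field.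
  (* The equation [p' = mu p] forces [mu = 2 k], where [k = tan (2 t)]. *)
  - exists (2 * k); refine (R4_ind _ _); intros w r.
    change (lowered_geodesic horocycle_metric (u t, s t) (u1 t, s1 t)
      (u2 t, s2 t) (w, r)
      = 2 * k * horocycle_metric (u t, s t) (u1 t, s1 t) (w, r)).
    rewrite lowered_geodesic_eq by exact HB.
    rewrite Fp, Fq, Fm, Ep, Eq, Em, Es1, Es2.
    unfold horocycle_metric, mc_eta; cbn [fst snd]; rewrite Ep, Eq, Em.
    replace (mc_p (u t) w * s1 t / s t) with (mc_p (u t) w * (s1 t / s t))
      by (field; auto).
    rewrite Es1, Ep1, Eq1, Eq'; field; auto.
Qed.

Lemma explicit_horocycle_chain (g : R -> mat2) :
  (forall t, in_range t -> g t = explicit_chain c t) ->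
  horocycle_chain (Finite (- (PI / 4))) (Finite (PI / 4)) g.
Proof.
  intros Hg; exists u; split.
  { intros t Ha Hb; split; [apply explicit_dom | ].
    rewrite Hg by (split; assumption); apply explicit_chart. }
  split; [exact adapted_horocycle_coframe | split].
  (* The ray is the image under [h]: [omega1 = m / s = 1] gives [m = s], and
     [omega2 = s (q + m) = 1] gives [q = 1 / s - s]. *)
  - exists (fun t => mc_vec (u t) 0 (/ s t - s t) (s t)).
    exists horocycle_alpha, (fun _ => - 2), s.
    split; [exact horocycle_connection | ].
    assert (HB : forall t : R, Rbar_lt (- (PI / 4)) t -> Rbar_lt t (PI / 4) ->
              Bset chart_dom (u t, s t)).
    { intros t Ha Hb; split; [apply explicit_dom | ].
      apply explicit_s_neq0; split; assumption. }
    split.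
    { apply (null_geodesic_horocycle _ _ _ _ _ horocycle_connection HB).
      exact explicit_null_geodesic. }
    split.
    + intros t Ha Hb; split; [now apply HB | ].
      assert (S := explicit_s_neq0 t (conj Ha Hb)).
      assert (N := explicit_dom t).
      destruct (mc_of_vec (u t) 0 (/ s t - s t) (s t) N) as (Ep & Eq & Em).
      split; [now apply Dplane_iff | split].
      * intros L; apply L_ellipse_iff in L; [ | exact N].
        destruct L as [_ L]; unfold mc_eta in L; rewrite Eq, Em in L.
        apply (Rinv_neq_0_compat _ S); lra.
      * intros L; apply L_point_iff in L; [ | exact N].
        apply S; rewrite <- Em; apply L.
    + left; intros t Ha Hb.
      assert (S := explicit_s_neq0 t (conj Ha Hb)).
      destruct (mc_of_vec (u t) 0 (/ s t - s t) (s t) (explicit_dom t))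
        as (Ep & Eq & Em).
      exists (mc_vec (u t) 0 (/ s t - s t) (s t)).
      unfold omega1, omega2, omega3; simpl eta1; simpl eta2; simpl eta3.
      cbn [fst snd]; rewrite Ep, Eq, Em.
      split; [field; auto | split; [field; auto | split; [reflexivity | ]]].
      exists 1; split; [lra | symmetry; exact (scal_one (V := R3) _)].
  - intros t Ha Hb; exists (u1 t); split.
    + apply explicit_is_derive_u; split; assumption.
    + assert (N := explicit_dom t); intros L.
      apply Dplane_iff in L; [ | exact N].
      unfold u1 in L.
      rewrite (proj1 (mc_of_vec (u t) (p t) (q t) 1 N)) in L.
      assert (P := cos_double_pos t (conj Ha Hb)).
      revert L; unfold p, chain_p, sec.
      (* Transversality is where [c <> 0] enters: the contact form takes the value [c sec (2 t)] on
         the velocity. *)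
      apply Rmult_integral_contrapositive_currified; [exact c0 | ].
      apply Rinv_neq_0_compat; lra.
Qed.

End ExplicitChain.

(** * The curve of the explicit chain *)

Lemma double_angle (C S : R) :
  0 < C -> C ^ 2 + S ^ 2 = 1 ->
  exists t, in_range t /\ cos (2 * t) = C /\ sin (2 * t) = S.
Proof.
  intros HC H; assert (HS : -1 < S < 1) by (split; nra).
  exists (asin S / 2); replace (2 * (asin S / 2)) with (asin S) by field.
  destruct (asin_bound_lt S HS) as [B1 B2].
  split; [unfold in_range; lra | split; [ | apply sin_asin; lra]].
  rewrite cos_asin by lra.
  replace (1 - S²) with (C ^ 2) by (unfold Rsqr; lra).
  apply sqrt_pow2; lra.
Qed.

Lemma angle (x y : R) :
  x ^ 2 + y ^ 2 = 1 -> Rabs y < x ->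
  exists t, in_range t /\ cos t = x /\ sin t = y.
Proof.
  intros H L; apply Rabs_def2 in L.
  destruct (double_angle (x ^ 2 - y ^ 2) (2 * x * y)) as (t & Ht & C & S).
  - nra.
  - rewrite <- (Rmult_1_l 1), <- H; ring.
  - exists t; assert (P : 0 < cos t) by (destruct Ht; apply cos_gt_0; lra).
    assert (N := cos2_sin2 t); rewrite <- cos_double in C.
    rewrite sin_2a in S.
    assert (E : cos t = x) by nra.
    split; [exact Ht | split; [exact E | ]].
    rewrite E in S; nra.
Qed.

Lemma hproj_chain_mat (c x y : R) :
  x ^ 2 + y ^ 2 = 1 -> x ^ 2 - y ^ 2 <> 0 ->
  let C := x ^ 2 - y ^ 2 in let S := 2 * x * y in let e := c / C in
  let D := 1 - e * S + e ^ 2 * (1 - C) / 2 in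
  hproj (chain_mat c x y) = ((- c + e ^ 2 * S / 2) / D + c, 1 / D).
Proof.
  intros H HC; cbv zeta.
  destruct (chain_mat_gram c x y H HC) as (_ & E2 & E3).
  assert (D := chain_mat_det c x y H); unfold SL2, det2 in D.
  assert (P := sum_squares_pos _ _ _ _ D); rewrite E3 in P.
  destruct (chain_mat c x y) as [[a k] [b d]]; cbn [fst snd] in *.
  rewrite hproj_eq, D, E2, E3.
  match type of E3 with _ = ?e => set (l := e) in * end.
  match type of E2 with _ = ?e + _ => set (m := e) in * end.
  clearbody l m; apply f_equal2; [field; lra | reflexivity].
Qed.

(** The quartic determines [C = cos (2 tau)] and [S = sin (2 tau)]. *)
Lemma quartic_point (c X Y : R) :
  c <> 0 -> 0 < Y -> horocycle_quartic c (X, Y) = 0 ->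
  exists C S, C <> 0 /\ C ^ 2 + S ^ 2 = 1 /\
    forall x y, x ^ 2 + y ^ 2 = 1 -> x ^ 2 - y ^ 2 = C -> 2 * x * y = S ->
      hproj (chain_mat c x y) = (X, Y).
Proof.
  intros Hc HY HQ; assert (Y0 : Y <> 0) by lra.
  (* Gram entries of the point after the shear that moves [(c, 1)] to [i]. In trace [T] and half
     difference [u], [G] below is the quartic and [U] is the determinant condition
     [a D - b^2 = 1]. *)
  set (b := (X - c) / Y); set (D := / Y); set (a := ((X - c) ^ 2 + Y ^ 2) / Y).
  set (u := (a - D) / 2); set (T := a + D).
  assert (G : (T - 2) ^ 2 = 4 * (b + c) ^ 2 + c ^ 2 * (T - 2)).
  { apply Rminus_diag_uniq.
    transitivity (horocycle_quartic c (X, Y) * / Y ^ 2);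
      [ | rewrite HQ; ring].
    unfold horocycle_quartic, T, a, b, D; cbn [Re Im fst snd]; field; exact Y0. }
  assert (U : 4 * u ^ 2 = T ^ 2 - 4 - 4 * b ^ 2)
    by (unfold u, T, a, b, D; field; exact Y0).
  assert (HT' : 0 <= T - 2).
  { replace (T - 2) with (((X - c) ^ 2 + (Y - 1) ^ 2) / Y)
        by (unfold T, a, D; field; exact Y0).
    apply Rmult_le_pos; [ | left; now apply Rinv_0_lt_compat].
    apply Rplus_le_le_0_compat; apply pow2_ge_0. }
  assert (Eb : b = (X - c) / Y) by reflexivity.
  assert (ED : D = / Y) by reflexivity.
  assert (ET : D = T / 2 - u) by (unfold T, u; field).
  clearbody u T; clear a; clearbody b D.
  (* Equality would put the point at [(c, 1)], where [b = 0] and [G] reads [0 = 4 c^2]. *)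
  assert (HT : 0 < T - 2).
  { destruct (Req_dec T 2) as [E | E]; [exfalso | lra].
    rewrite E in G, U; assert (b = 0) by nra; nra. }
  assert (T0 : T - 2 <> 0) by lra.
  (* Inverting [chain_mat_gram]: with [e = c / C] it gives [T - 2 = e^2] and [b + c = e^2 S / 2],
     hence [S] and [C^2]. *)
  set (S := 2 * (b + c) / (T - 2)).
  set (C0 := sqrt (c ^ 2 / (T - 2))).
  assert (c2 : 0 < c ^ 2) by now apply pow2_gt_0.
  assert (P0 : 0 < c ^ 2 / (T - 2)) by now apply Rdiv_lt_0_compat.
  assert (C02 : C0 ^ 2 = c ^ 2 / (T - 2)) by (apply pow2_sqrt; lra).
  assert (N : c ^ 2 / (T - 2) + S ^ 2 = 1).
  { transitivity ((c ^ 2 * (T - 2) + 4 * (b + c) ^ 2) / (T - 2) ^ 2).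
    - unfold S; field; lra.
    - replace (c ^ 2 * (T - 2) + 4 * (b + c) ^ 2) with ((T - 2) ^ 2) by lra.
      field; lra. }
  assert (E : (2 * u * C0) ^ 2 = (c ^ 2 + 2 * c * S) ^ 2).
  { replace ((2 * u * C0) ^ 2) with (4 * u ^ 2 * C0 ^ 2) by ring.
    rewrite U, C02.
    replace ((c ^ 2 + 2 * c * S) ^ 2)
      with (c ^ 4 + 4 * c ^ 3 * S + 4 * c ^ 2 * S ^ 2) by ring.
    replace (S ^ 2) with (1 - c ^ 2 / (T - 2)) by lra.
    unfold S; apply (Rmult_eq_reg_r ((T - 2) / c ^ 2)).
    2: apply Rgt_not_eq, Rdiv_lt_0_compat; lra.
    transitivity (T ^ 2 - 4 - 4 * b ^ 2); [field; lra | ].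
    transitivity (c ^ 2 * (T - 2) + 8 * c * (b + c) + 4 * (T - 2) - 4 * c ^ 2);
      [ | field; lra].
    lra. }
  (* The sign of [C] comes from [u = e S + e^2 C / 2], that is [2 u C = c^2 + 2 c S]. The squares of
     both sides agree by [E], so one of the two roots satisfies it. *)
  assert (EC : exists C, C ^ 2 = c ^ 2 / (T - 2)
                 /\ 2 * u * C = c ^ 2 + 2 * c * S).
  { assert (F : (2 * u * C0 - (c ^ 2 + 2 * c * S))
                * (2 * u * C0 + (c ^ 2 + 2 * c * S)) = 0) by lra.
    apply Rmult_integral in F; destruct F as [F | F].
    - exists C0; split; [exact C02 | lra].
    - exists (- C0); split; [rewrite <- C02; ring | lra]. }
  destruct EC as (C & C2 & CU).
  assert (C_0 : C <> 0) by (intros Z; rewrite Z in C2; lra).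
  exists C, S; split; [exact C_0 | split; [lra | ]].
  intros x y H1 H2 H3.
  assert (H2' : x ^ 2 - y ^ 2 <> 0) by now rewrite H2.
  rewrite (hproj_chain_mat c x y H1 H2'), H2, H3.
  assert (e2 : (c / C) ^ 2 = T - 2).
  { transitivity (c ^ 2 / C ^ 2); [field; auto | rewrite C2; field; lra]. }
  assert (ED' : 1 - c / C * S + (c / C) ^ 2 * (1 - C) / 2 = D).
  { rewrite ET.
    replace u with ((c ^ 2 + 2 * c * S) / (2 * C))
      by (rewrite <- CU; field; auto).
    transitivity (1 + (c / C) ^ 2 / 2 - (c ^ 2 + 2 * c * S) / (2 * C));
      [field; auto | rewrite e2; field; auto]. }
  assert (EB : - c + (c / C) ^ 2 * S / 2 = b).
  { rewrite e2; unfold S; field; lra. }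
  rewrite ED', EB, Eb, ED; apply f_equal2; field; exact Y0.
Qed.

(** [A] is the quarter turn conjugated by the shears bringing [(c, 1)] and
    [(-c, 1)] to [i]; [tau] becomes [tau + PI / 2]. *)
Lemma opposite_chain (c x y : R) :
  x ^ 2 - y ^ 2 <> 0 ->
  mat_mul ((c, 1), (c ^ 2 - 1, c)) (chain_mat (- c) x y) = chain_mat c (- y) x.
Proof.
  intros H; unfold chain_mat; cbv zeta; rewrite mat_mul_eq.
  replace ((- y) ^ 2 - x ^ 2) with (- (x ^ 2 - y ^ 2)) by ring.
  apply mat_ext; field; lra.
Qed.

(** Each point of the quartic comes from a point [(C, S)] of the unit circle with [C <> 0]. The half
    [C > 0] is the chain itself; the half [C < 0] is reached by a quarter turn in [tau] and is the
    translated chain of [- c]. *)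
Lemma quartic_curve (c : R) (z : C) :
  c <> 0 -> half_plane z ->
  horocycle_quartic c z = 0 <->
  (exists t, in_range t /\ z = hproj (explicit_chain c t)) \/
  (exists t, in_range t /\
     z = hproj (mat_mul ((c, 1), (c ^ 2 - 1, c)) (explicit_chain (- c) t))).
Proof.
  intros Hc Hz; split.
  - destruct z as [X Y]; intros HQ.
    destruct (quartic_point c X Y Hc Hz HQ) as (C & S & C0 & N & E).
    destruct (Rlt_or_le 0 C) as [L | L].
    + left; destruct (double_angle C S L N) as (t & Ht & HC & HS).
      exists t; split; [exact Ht | symmetry; apply E].
      * apply cos2_sin2.
      * now rewrite cos_double.
      * rewrite <- HS, sin_2a; ring.
    + right; destruct (double_angle (- C) (- S)) as (t & Ht & HC & HS);
        [lra | rewrite <- N; ring | ].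
      exists t; split; [exact Ht | ].
      assert (P := cos_double_pos t Ht); assert (D := cos_double t).
      unfold explicit_chain; rewrite opposite_chain by lra.
      symmetry; apply E.
      * rewrite <- (cos2_sin2 t); ring.
      * replace ((- sin t) ^ 2 - cos t ^ 2) with (- (cos t ^ 2 - sin t ^ 2))
          by ring.
        lra.
      * rewrite sin_2a in HS; lra.
  - intros [(t & Ht & ->) | (t & Ht & ->)];
      assert (P := cos_double_pos t Ht); assert (D := cos_double t);
      unfold explicit_chain.
    + apply chain_mat_quartic; [apply cos2_sin2 | lra].
    + rewrite opposite_chain by lra.
      apply chain_mat_quartic.
      * rewrite <- (cos2_sin2 t); ring.
      * replace ((- sin t) ^ 2 - cos t ^ 2) with (- (cos t ^ 2 - sin t ^ 2))
          by ring.
        lra.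
Qed.

(** * The Hooke ellipse and the reflection *)

Lemma on_hooke_ellipse_iff (c : R) (r : R2) :
  on_hooke_ellipse (c, 1) r <->
  (fst r - c * snd r) ^ 2 + snd r ^ 2 = 1.
Proof.
  destruct r as [x y]; unfold on_hooke_ellipse; cbn [Re Im fst snd].
  split; intros H; lra.
Qed.

(** Here [x - c y = cos tau] and [y = sin tau], and the range of [tau] amounts to
    [|sin tau| < cos tau]: the chain runs over an arc of the ellipse. *)
Lemma explicit_chain_points (c : R) (r : R2) :
  (exists t, in_range t /\ r = fst (explicit_chain c t)) <->
  (fst r - c * snd r) ^ 2 + snd r ^ 2 = 1 /\
  Rabs (snd r) < fst r - c * snd r.
Proof.
  split.
  - intros (t & Ht & ->); rewrite explicit_chain_eq; cbn [fst snd].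
    replace (cos t + c * sin t - c * sin t) with (cos t) by ring.
    split; [apply cos2_sin2 | ].
    assert (P := cos_double_pos t Ht); rewrite <- cos_double in P.
    assert (0 < cos t) by (destruct Ht; apply cos_gt_0; lra).
    apply Rabs_def1; nra.
  - destruct r as [x0 y0]; revert x0 y0; cbn [fst snd].
    change (forall x y : R, (x - c * y) ^ 2 + y ^ 2 = 1 /\ Rabs y < x - c * y ->
      exists t, in_range t /\ (x, y) = fst (explicit_chain c t)).
    intros x y [N L].
    destruct (angle (x - c * y) y N L) as (t & Ht & HC & HS).
    exists t; split; [exact Ht | rewrite explicit_chain_eq; cbn [fst snd]].
    rewrite HC, HS; apply R2_ext; ring.
Qed.

Lemma refl_conj_eq (a b c d : R) :
  refl_conj ((a, c), (b, d)) = ((a, - c), (- b, d)).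
Proof.
  unfold refl_conj, refl_mat; rewrite !mat_mul_eq; apply mat_ext; ring.
Qed.

Lemma refl_conj_explicit_chain (c t : R) :
  refl_conj (explicit_chain c t) = explicit_chain (- c) (- t).
Proof.
  rewrite !explicit_chain_eq, refl_conj_eq; unfold chain_p, sec.
  replace (2 * - t) with (- (2 * t)) by ring.
  rewrite !cos_neg, !sin_neg; apply mat_ext; ring.
Qed.

Lemma in_range_opp t : in_range t -> in_range (- t).
Proof. unfold in_range; lra. Qed.

Theorem proposition4p11 :
  (* (i) *)
  (forall (a b : Rbar) (g : R -> mat2),
     Rbar_lt a b -> horocycle_chain a b g ->
     (exists A : mat2, SL2 A /\
        forall t : R, Rbar_lt a t -> Rbar_lt t b ->
          is_diagonal (mat_mul A (g t))) \/
     (exists (A : mat2) (c : R), SL2 A /\ c <> 0 /\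
        forall t : R, Rbar_lt a t -> Rbar_lt t b ->
          half_plane (hproj (mat_mul A (g t))) /\
          horocycle_quartic c (hproj (mat_mul A (g t))) = 0)) /\
  (forall c : R, c <> 0 ->
     (exists g : R -> mat2, chain_solution c g) /\
     forall g gm : R -> mat2, chain_solution c g -> chain_solution (- c) gm ->
     (* (ii) *)
     horocycle_chain (Finite (- (PI / 4))) (Finite (PI / 4)) g /\
     (forall tau : R, in_range tau ->
        half_plane (hproj (g tau)) /\ horocycle_quartic c (hproj (g tau)) = 0) /\
     (exists A : mat2, SL2 A /\
        forall z : C, half_plane z ->
          (horocycle_quartic c z = 0 <->
           (exists tau : R, in_range tau /\ z = hproj (g tau)) \/
           (exists tau : R, in_range tau /\ z = hproj (mat_mul A (gm tau))))) /\
     (* (iii) *)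
     (forall p : R2,
        on_hooke_ellipse (c, 1) p <->
        (fst p - c * snd p) ^ 2 + snd p ^ 2 = 1) /\
     (forall p : R2,
        (exists tau : R, in_range tau /\ p = fst (g tau)) <->
        (fst p - c * snd p) ^ 2 + snd p ^ 2 = 1 /\
        Rabs (snd p) < fst p - c * snd p) /\
     (forall tau : R, in_range tau -> on_horocycle (fst (g tau)) (c, 1)) /\
     (* (iv) *)
     (forall k : mat2,
        (exists tau : R, in_range tau /\ k = gm tau) <->
        (exists tau : R, in_range tau /\ k = refl_conj (g tau)))) /\
  (forall k : mat2, SL2 k -> SL2 (refl_conj k)) /\
  (forall k : mat2, refl_conj (refl_conj k) = k) /\
  (forall k k' : mat2,
     refl_conj (mat_mul k k') = mat_mul (refl_conj k) (refl_conj k')) /\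
  ~ (exists A : mat2, SL2 A /\
       forall k : mat2, SL2 k -> mat_mul (refl_conj k) A = mat_mul A k) /\
  (forall k : mat2, SL2 k ->
     hproj (refl_conj k) = (- Re (hproj k), Im (hproj k))).
Proof.
  split; [exact horocycle_chain_projection | ].
  split; [intros c Hc; split | ].
  - exists (explicit_chain c); apply explicit_chain_solution.
  - intros g gm Hg Hgm.
    assert (Eg := fun t => chain_solution_unique c g t Hg).
    assert (Em := fun t => chain_solution_unique (- c) gm t Hgm).
    assert (X : forall (P : mat2 -> Prop),
      (exists t, in_range t /\ P (g t)) <->
      (exists t, in_range t /\ P (explicit_chain c t))).
    { intros P; split; intros (t & Ht & H); exists t; split; auto;
        [rewrite <- Eg | rewrite Eg]; auto. }
    assert (Xm : forall (P : mat2 -> Prop),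
      (exists t, in_range t /\ P (gm t)) <->
      (exists t, in_range t /\ P (explicit_chain (- c) t))).
    { intros P; split; intros (t & Ht & H); exists t; split; auto;
        [rewrite <- Em | rewrite Em]; auto. }
    split; [now apply (explicit_horocycle_chain c) | ].
    split.
    { intros t Ht; rewrite Eg by exact Ht.
      assert (P := cos_double_pos t Ht); rewrite <- cos_double in P.
      apply chain_mat_quartic; [apply cos2_sin2 | lra]. }
    split.
    { exists ((c, 1), (c ^ 2 - 1, c)); split.
      - unfold SL2, det2; cbn [fst snd]; ring.
      - intros z Hz.
        rewrite (X (fun k => z = hproj k)).
        rewrite (Xm (fun k =>
          z = hproj (mat_mul ((c, 1), (c ^ 2 - 1, c)) k))).
        now apply quartic_curve. }
    split; [apply on_hooke_ellipse_iff | split; [ | split]].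
    + intros r; rewrite (X (fun k => r = fst k)).
      apply explicit_chain_points.
    + intros t Ht; rewrite Eg by exact Ht; split.
      * unfold half_plane, Im; cbn [snd]; lra.
      * apply on_hooke_ellipse_iff, explicit_chain_points.
        now exists t.
    + intros k; rewrite (X (fun m => k = refl_conj m)).
      rewrite (Xm (fun m => k = m)).
      split; intros (t & Ht & ->); exists (- t);
        (split; [now apply in_range_opp | ]);
        rewrite refl_conj_explicit_chain, ?Ropp_involutive; reflexivity.
  - split; [ | split; [ | split; [ | split]]].
    + refine (mat2_ind _ _); intros a b c d.
      rewrite refl_conj_eq; unfold SL2, det2;
        cbn [fst snd]; intros H; lra.
    + refine (mat2_ind _ _); intros a b c d.
      rewrite !refl_conj_eq; apply mat_ext; ring.
    + refine (mat2_ind _ _); intros a b c d.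
      refine (mat2_ind _ _); intros a' b' c' d'.
      rewrite mat_mul_eq, !refl_conj_eq, mat_mul_eq; apply mat_ext; ring.
    + intros [A HA]; revert A HA; refine (mat2_ind _ _).
      intros a b c d [D H].
      (* The reflection sends this shear to its inverse. A matrix intertwining the two has [c = 0]
         and [d = - a], so its determinant is [- a^2], never [1]. *)
      assert (E := H ((1, 0), (1, 1))).
      rewrite refl_conj_eq, !mat_mul_eq in E.
      unfold SL2, det2 in D, E; cbn [fst snd] in D, E.
      assert (E' := E ltac:(ring)); injection E' as E1 E2 E3 E4; nra.
    + refine (mat2_ind _ _); intros a b c d _; rewrite refl_conj_eq, !hproj_eq.
      unfold Re, Im; cbn [fst snd].
      replace ((- c) ^ 2) with (c ^ 2) by ring.
      unfold Rdiv; apply f_equal2; ring.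
Qed.
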